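(* Let $n\ge 3$. The local normalizing graph of $G=\mathbb{Z}/2^n\mathbb{Z}$ is made up of the following connected components. (i) One connected component containing the clique $H$ and the subgroups $N_1,\dots,N_6$, composed of $2^{n-\lceil n/2\rceil}+4$ regular subgroups. Here $|H|=2^{n-\lceil n/2\rceil}$ and $N_1,N_2\in H$; the edges of this component are exactly: all edges between distinct elements of $H$, all edges between distinct elements of $\{N_1,N_2,N_3,N_4\}$, and all edges between distinct elements of $\{N_3,N_4,N_5,N_6\}$. (ii) $\frac13\left(2^{n-3}-2^{n-2\lceil n/2\rceil+1}\right)$ connected components $A_u^t$, for $2\le u<\lceil n/2\rceil$ and $0\le t<2^{n-2u-1}$, each of which is a clique composed of $2^u$ regular subgroups. (iii) (For $n\ge 4$) $2^{n-3}$ connected components $S_k$, for $0\le k<2^{n-3}$, each of which is a clique composed of $4$ regular subgroups.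
   Context: Maps act on the right: $x^\alpha$ is the image of $x$ under $\alpha$, and products of permutations are composed left to right. $G=\mathbb{Z}/2^n\mathbb{Z}$ is written additively; $\sigma_k\colon G\to G$, $x\mapsto kx$. $\rho(g)\colon x\mapsto x+g$, and $\mathrm{Hol}(G)=\langle\rho(G),\mathrm{Aut}(G)\rangle\le\mathrm{Sym}(G)$. The local normalizing graph of $G$ is the undirected graph whose vertices are the regular subgroups of $\mathrm{Hol}(G)$ (subgroups acting regularly on the set $G$), two distinct vertices $N,M$ being joined by an edge if and only if $N$ and $M$ mutually normalize each other, i.e. each is contained in the normalizer of the other in $\mathrm{Sym}(G)$. A gamma function on $G$ is a map $\gamma\colon G\to\mathrm{Aut}(G)$ with $\gamma(g^{\gamma(h)}+h)=\gamma(g)\gamma(h)$ for all $g,h$. Regular subgroups of $\mathrm{Hol}(G)$ correspond bijectively to gamma functions via $N=\{\gamma(g)\rho(g):g\in G\}$; below, sets of gamma functions are identified with the sets of the associated regular subgroups. Gamma functions: $\gamma_1(x)=\sigma_1$; $\gamma_2(x)=\sigma_{2^{n-1}+1}^x$; $\gamma_3(x)=\sigma_{2^{n-1}-1}^x$; $\gamma_4(x)=\sigma_{2^n-1}^x$; $\gamma_5(x)=\sigma_1,\sigma_{2^{n-1}-1},\sigma_{2^{n-1}+1},\sigma_{2^n-1}$ for $x\equiv 0,1,2,3\pmod 4$ respectively; $\gamma_6(x)=\sigma_1,\sigma_{2^n-1},\sigma_{2^{n-1}+1},\sigma_{2^{n-1}-1}$ for $x\equiv0,1,2,3\pmod 4$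 respectively. $N_i$ is the regular subgroup associated with $\gamma_i$. Further, $\gamma_{\mathsf c,u}(x)=\sigma_{2^ux+1}$ for $2\le u\le n$ (so $\gamma_{\mathsf c,n}=\gamma_1$, $\gamma_{\mathsf c,n-1}=\gamma_2$), and for $n\ge4$: $\gamma_{\mathsf p}(x)=\sigma_{2x+1}$; $\gamma_{\mathsf m}(x)=\sigma_{2x+1}$ if $x$ is even and $\gamma_{\mathsf m}(x)=\sigma_{2x+2^{n-2}+1}$ if $x$ is odd. For a gamma function $\gamma$ and an integer $k$, $\gamma^k$ denotes the gamma function $\gamma^k(x)=\gamma((2k+1)x)$; it is the gamma function of the conjugate of the regular subgroup of $\gamma$ under $\sigma_{2k+1}^{-1}\in\mathrm{Aut}(G)$. Set $$H=\{\gamma_{\mathsf c,u}^k: \lceil n/2\rceil\le u\le n,\ 0\le k<2^{n-1}\},$$ $$A_u^t=\{\gamma_{\mathsf c,u}^k: 0\le k<2^{n-1},\ k\equiv t \pmod{2^{n-2u-1}}\}\quad (2\le u<\lceil n/2\rceil,\ 0\le t<2^{n-2u-1}),$$ $$S_k=\{\gamma_{\mathsf p}^{k},\ \gamma_{\mathsf m}^{k+2^{n-4}},\ \gamma_{\mathsf p}^{k+2^{n-3}},\ \gamma_{\mathsf m}^{k+2^{n-3}+2^{n-4}}\}\quad(n\ge 4).$$ A clique is a complete subgraph. *)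

(* Defs.v *)
From mathcomp Require Import all_boot all_order all_algebra all_fingroup.

Set Implicit Arguments.
Unset Strict Implicit.
Unset Printing Implicit Defensive.

Import GRing.Theory GroupScope.

Local Open Scope ring_scope.

(* The modulus 2 ^ n is > 1 in all uses (n >= 3), so this is really Z/2^nZ.
   Its finGroupType structure is the additive one, hence Aut [set: ZG n] is the
   group of automorphisms of the additive group.  Products in {perm ZG n} are
   composed left to right. *)
Notation ZG n := 'Z_(2 ^ n).

Section LocalNormalizingGraph.

Variable n : nat.

Definition rho (g : ZG n) : {perm ZG n} := perm (addIr g).

Definition Hol : {group {perm ZG n}} :=
  <<(rho @: [set: ZG n]) :|: Aut [set: ZG n]>>%G.

Definition acts_regularly (N : {set {perm ZG n}}) : bool :=
  [transitive N, on [set: ZG n] | 'P] && [forall x : ZG n, 'C_N[x | 'P] == 1%g].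

(* Vertices are kept as plain sets of permutations, so that being a group is
   part of being a vertex. *)
Definition vertices : {set {set {perm ZG n}}} :=
  [set N | [&& group_set N, N \subset Hol & acts_regularly N]].

Definition edge : rel {set {perm ZG n}} := fun N M =>
  [&& N \in vertices, M \in vertices, N != M,
      N \subset 'N(M) & M \subset 'N(N)].

Definition connected_components : {set {set {set {perm ZG n}}}} :=
  equivalence_partition (connect edge) vertices.

Definition clique (K : {set {set {perm ZG n}}}) : Prop :=
  {in K &, forall N M, N != M -> edge N M}.

End LocalNormalizingGraph.

Section GammaFunctions.

Variable n : nat.

(* x |-> k x; the default value 1 is returned only when this map is not
   bijective, i.e. when k is even, which never occurs below (gamma_c is used for
   u >= 2 only). *)
Definition sigma (k : ZG n) : {perm ZG n} :=
  insubd (1%g : {perm ZG n}) [ffun x : ZG n => k * x].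

Lemma sigmaE (k x : ZG n) : k \is a GRing.unit -> sigma k x = k * x.
Proof.
move=> kU; have kI : injectiveb [ffun y : ZG n => k * y].
  by apply/injectiveP => y z; rewrite !ffunE; apply: mulrI.
by rewrite -pvalE val_insubd kI ffunE.
Qed.

Lemma sigma_Aut (k : ZG n) : k \is a GRing.unit -> sigma k \in Aut [set: ZG n].
Proof.
move=> kU; rewrite inE; apply/andP; split; first by apply/subsetP=> x; rewrite inE.
by apply/morphicP => x y _ _; rewrite !sigmaE // -[LHS]/(k * (x + y)) mulrDr.
Qed.

Implicit Type gamma : ZG n -> {perm ZG n}.

Definition gamma_function gamma : Prop :=
  (forall g, gamma g \in Aut [set: ZG n]) /\
  (forall g h, gamma (gamma h g + h) = (gamma g * gamma h)%g).

Definition subgroup_of gamma : {set {perm ZG n}} :=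
  [set (gamma g * rho g)%g | g : ZG n].

Lemma subgroup_of_vertex gamma :
  gamma_function gamma -> subgroup_of gamma \in vertices n.
Proof.
case=> gA gM.
have gD h x y : gamma h (x + y) = gamma h x + gamma h y.
  have := gA h; rewrite inE => /andP[_ /morphicP]; apply; exact: in_setT.
have g0 h : gamma h 0 = 0 by apply: (addIr (gamma h 0)); rewrite -gD !add0r.
have gm0 : gamma 0 = 1%g.
  by apply: (mulgI (gamma 0)); rewrite -gM g0 addr0 mulg1.
have rhoE g x : rho g x = x + g by rewrite permE.
have N0 : group_set (subgroup_of gamma).
  apply/group_setP; split.
    apply/imsetP; exists 0 => //; rewrite gm0 mul1g.
    by apply/permP => x; rewrite rhoE perm1 addr0.
  move=> _ _ /imsetP[g _ ->] /imsetP[h _ ->].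
  apply/imsetP; exists (gamma h g + h) => //; apply/permP => x.
  by rewrite gM !permM !rhoE gD addrA.
rewrite inE N0 /=; apply/andP; split.
  apply/subsetP => _ /imsetP[g _ ->]; apply: groupM; apply: mem_gen; rewrite inE.
    by rewrite gA orbT.
  by rewrite imset_f.
have N0E g : (gamma g * rho g)%g 0 = g by rewrite permM rhoE g0 add0r.
have trN : [transitive Group N0, on [set: ZG n] | 'P].
  apply/imsetP; exists 0 => //; apply/esym/setP => x; rewrite inE.
  apply/orbitP; exists (gamma x * rho x)%g; first exact: imset_f.
  by rewrite /= /aperm N0E.
apply/andP; split=> //; apply/forallP => x.
have stab0 : 'C_(Group N0)[0 : ZG n | 'P] = 1%g :> {set _}.
  apply/eqP; rewrite eqEsubset sub1G andbT.
  apply/subsetP => _ /setIP[/imsetP[g _ ->]].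
  move/astab1P; rewrite /= /aperm N0E => ->.
  by rewrite gm0 mul1g inE; apply/eqP/permP=> y; rewrite rhoE perm1 addr0.
have [a aN ax] := atransP2 trN (in_setT (0 : ZG n)) (in_setT x).
have -> : subgroup_of gamma = Group N0 :> {set _} by [].
by rewrite ax astab1_act -(conjGid aN) -conjIg stab0 conjs1g.
Qed.

(* In the exponents and in the congruences modulo 4 below, x : ZG n is read as
   its representative in [0, 2 ^ n); for n >= 3 the choice of representative is
   irrelevant, since the permutations raised to the power x are involutions and
   4 divides 2 ^ n. *)
Definition gamma1 : ZG n -> {perm ZG n} := fun=> sigma 1.
Definition gamma2 (x : ZG n) : {perm ZG n} :=
  (sigma (2 ^ (n - 1) + 1)%N%:R ^+ (x : nat))%g.
Definition gamma3 (x : ZG n) : {perm ZG n} :=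
  (sigma (2 ^ (n - 1) - 1)%N%:R ^+ (x : nat))%g.
Definition gamma4 (x : ZG n) : {perm ZG n} :=
  (sigma (2 ^ n - 1)%N%:R ^+ (x : nat))%g.
Definition gamma5 (x : ZG n) : {perm ZG n} :=
  match (x %% 4)%N with
  | 0 => sigma 1
  | 1 => sigma (2 ^ (n - 1) - 1)%N%:R
  | 2 => sigma (2 ^ (n - 1) + 1)%N%:R
  | _ => sigma (2 ^ n - 1)%N%:R
  end.
Definition gamma6 (x : ZG n) : {perm ZG n} :=
  match (x %% 4)%N with
  | 0 => sigma 1
  | 1 => sigma (2 ^ n - 1)%N%:R
  | 2 => sigma (2 ^ (n - 1) + 1)%N%:R
  | _ => sigma (2 ^ (n - 1) - 1)%N%:R
  end.

Definition gamma_c (u : nat) (x : ZG n) : {perm ZG n} := sigma (2 ^+ u * x + 1).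
Definition gamma_p (x : ZG n) : {perm ZG n} := sigma (2 * x + 1).
Definition gamma_m (x : ZG n) : {perm ZG n} :=
  if odd x then sigma (2 * x + 2 ^+ (n - 2) + 1) else sigma (2 * x + 1).

Definition gamma_pow gamma (k : nat) : ZG n -> {perm ZG n} :=
  fun x => gamma ((2 * k + 1)%N%:R * x).

Definition N1 := subgroup_of gamma1.
Definition N2 := subgroup_of gamma2.
Definition N3 := subgroup_of gamma3.
Definition N4 := subgroup_of gamma4.
Definition N5 := subgroup_of gamma5.
Definition N6 := subgroup_of gamma6.

(* Sets of gamma functions are given directly as the sets of the associated
   subgroups; uphalf n is the ceiling of n / 2. *)
Definition Hset : {set {set {perm ZG n}}} :=
  \bigcup_(u < n.+1 | (uphalf n <= u)%N)
    [set subgroup_of (gamma_pow (gamma_c u) k) | k : 'I_(2 ^ (n - 1))].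

(* Used for u < uphalf n only, where 2 * u + 1 <= n. *)
Definition Aset (u t : nat) : {set {set {perm ZG n}}} :=
  [set subgroup_of (gamma_pow (gamma_c u) k)
     | k : 'I_(2 ^ (n - 1)) & k == t %[mod 2 ^ (n - 2 * u - 1)]].

(* Used for n >= 4 only. *)
Definition Sset (k : nat) : {set {set {perm ZG n}}} :=
  [set subgroup_of (gamma_pow gamma_p k);
       subgroup_of (gamma_pow gamma_m (k + 2 ^ (n - 4)));
       subgroup_of (gamma_pow gamma_p (k + 2 ^ (n - 3)));
       subgroup_of (gamma_pow gamma_m (k + 2 ^ (n - 3) + 2 ^ (n - 4)))].

Definition main_component : {set {set {perm ZG n}}} :=
  Hset :|: [set N1; N2; N3; N4; N5; N6].

Definition A_family : {set {set {set {perm ZG n}}}} :=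
  \bigcup_(u < uphalf n | (2 <= u)%N)
    [set Aset u t | t : 'I_(2 ^ (n - 2 * u - 1))].

Definition S_family : {set {set {set {perm ZG n}}}} :=
  [set Sset k | k : 'I_(2 ^ (n - 3)) & (4 <= n)%N].

End GammaFunctions.

(* Main.v *)
Require Import Defs.
From mathcomp Require Import all_boot all_order all_algebra all_fingroup.
From mathcomp Require Import ring zify.

Import GRing.Theory GroupScope.

Local Open Scope ring_scope.

(** Why it is true.  The element of a regular subgroup N of the holomorph that
    sends 0 to g is x |-> f(g) x + g with f(g) odd, and N being a group says that
    f(f(h) g + h) = f(g) f(h).  As N acts without fixed points, f(2) = 1 + 2d
    with d even; spreading this value with the functional equation gives
    f(x) = 1 + d x for all even x ([f_even]), and then, with s = f(1) - 1, also
    f(x) = 1 + s + d (x - 1) for all odd x.  Such an f solves the functional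
    equation if and only if 2 d (s - d) = 0 and (s - d) (s + 2) = 0 ([slopeM],
    [gamma_equation_slope]).  So the vertices are the groups [vertex d s] for these
    pairs of even numbers, and two pairs give the same group exactly when s and
    2 d agree ([vertex_eq]).

    In these coordinates, (d, s) normalizes (d', s') if and only if
    2 d' (d - d') = 0 and d' (s - s') = 0 ([vertex_normP]), so that the whole
    graph is read off from products in Z/2^nZ.

    If s = 0 mod 4, then s + 2 is twice a unit, so 2 (s - d) = 0 and one may take
    d = s: these are the conjugates of the gamma_c.  Two of them, c and c', are
    adjacent when c (c - c') = c' (c - c') = 0, which forces (c - c')^2 = 0.  The
    multiples of 2^ceil(n/2) are therefore pairwise adjacent and joined to no other
    c; they form H.  If instead c is 2^u times a unit with 2u < n, its neighbours
    are the elements of c + 2^(n-u) Z; they form a set A_u^t.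

    If s = 2 mod 4, then either 4 d = 0 and 2 (s + 2) = 0, which leaves the four
    groups N_3, ..., N_6; or d is twice a unit, and being adjacent to (d', s')
    means 4 (d - d') = 0 and 2 (s - s') = 0, which leaves the four groups of some
    S_k; this second case is new only for n >= 4.  Finally a group c of the first type is adjacent to a group (d, s) of the
    second one only if 2 c = 2 d = 0 ([edge_mixed]): this joins N_1 and N_2 to N_3
    and N_4, and nothing else.  The cardinalities count residues modulo powers
    of 2. *)

Set Implicit Arguments.
Unset Strict Implicit.
Unset Printing Implicit Defensive.

(** Turns an equation into one that [ring] can decide, by subtracting multiples
    of known equations from both sides; meant to be chained. *)
Lemma lincomb (R : pzRingType) (c z w x y : R) :
  z = w -> x - c * z = y - c * w -> x = y.
Proof. by move=> -> /addIr. Qed.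

(** * Arithmetic in Z/2^nZ *)

Section Arithmetic.

Variable n : nat.
Hypothesis n_gt0 : (0 < n)%N.
Implicit Types (x y z w : ZG n) (m k u : nat).

Let modulus_gt1 : (1 < 2 ^ n)%N.
Proof. by rewrite -{1}(expn0 2) ltn_exp2l. Qed.

Lemma natr_eq_mod m k : m%:R = k%:R :> ZG n <-> m = k %[mod 2 ^ n].
Proof.
split=> [/(congr1 (@nat_of_ord _))|mk]; first by rewrite !val_Zp_nat.
by apply: val_inj; rewrite /= !val_Zp_nat.
Qed.

Lemma natr_ex x : exists m, x = m%:R.
Proof. by exists (x : nat); rewrite natr_Zp. Qed.

Lemma natr_eq0 m : m%:R = 0 :> ZG n <-> (2 ^ n %| m)%N.
Proof.
rewrite -[0]/(0%:R) natr_eq_mod mod0n; split; first by move/eqP.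
by move=> H; apply/eqP.
Qed.

Lemma pow2_mul_natr_eq k i j : (k <= n)%N ->
  2 ^+ k * i%:R = 2 ^+ k * j%:R :> ZG n <-> i = j %[mod 2 ^ (n - k)].
Proof.
move=> kn; rewrite -!natrX -!natrM natr_eq_mod.
have -> : (2 ^ n = 2 ^ k * 2 ^ (n - k))%N by rewrite -expnD subnKC.
rewrite -!muln_modr; split=> [/eqP|->//].
by rewrite eqn_pmul2l ?expn_gt0 // => /eqP.
Qed.

Lemma pow2n0 : 2 ^+ n = 0 :> ZG n.
Proof. by rewrite -natrX; apply/natr_eq0. Qed.

Lemma pow2_mul_eq0 k z :
  (k <= n)%N -> 2 ^+ k * z = 0 <-> exists w, z = 2 ^+ (n - k) * w.
Proof.
move=> kn; split=> [|[w ->]].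
  have [m ->] := natr_ex z; rewrite -natrX -natrM => /natr_eq0.
  rewrite -{1}(subnKC kn) expnD dvdn_pmul2l ?expn_gt0 // => /dvdnP[j ->].
  by exists j%:R; rewrite natrM natrX mulrC.
by rewrite mulrA -exprD subnKC // pow2n0 mul0r.
Qed.

Lemma odd_natr m : odd (m%:R : ZG n) = odd m.
Proof. by rewrite val_Zp_nat // odd_mod // oddX orbF gtn_eqF. Qed.

Lemma oddDr x y : odd (x + y)%R = odd x (+) odd y.
Proof.
have [[a ->] [b ->]] := (natr_ex x, natr_ex y).
by rewrite -natrD !odd_natr oddD.
Qed.

Lemma oddMr x y : odd (x * y)%R = odd x && odd y.
Proof.
have [[a ->] [b ->]] := (natr_ex x, natr_ex y).
by rewrite -natrM !odd_natr oddM.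
Qed.

Lemma oddNr x : odd (- x)%R = odd x.
Proof.
by have := oddDr x (- x); rewrite subrr; case: (odd x); case: (odd (- x)%R).
Qed.

Lemma oddBr x y : odd (x - y)%R = odd x (+) odd y.
Proof. by rewrite oddDr oddNr. Qed.

Lemma odd2r x : odd (2 * x)%R = false.
Proof. by rewrite oddMr (odd_natr 2). Qed.

Lemma odd1r : odd (1 : ZG n)%R.
Proof. by rewrite (odd_natr 1). Qed.

Definition oddrE := (oddDr, oddBr, oddNr, odd2r, odd1r, oddMr).

Lemma unitr_odd x : (x \is a GRing.unit) = odd x.
Proof.
have [m ->] := natr_ex x.
by rewrite unitZpE // coprime_pexpl // coprime2n odd_natr.
Qed.

Variant parity_spec x : bool -> Prop :=
  | IsEven w of x = 2 * w : parity_spec x false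
  | IsOdd w of x = 2 * w + 1 : parity_spec x true.

Lemma parityP x : parity_spec x (odd x).
Proof.
have [m ->] := natr_ex x; rewrite odd_natr -{1}(odd_double_half m) -mul2n.
by case: (odd m); [apply: (@IsOdd _ m./2%:R)|apply: (@IsEven _ m./2%:R)];
  rewrite natrD natrM // ?add0r // addrC.
Qed.

Lemma evenP x : odd x = false -> exists w, x = 2 * w.
Proof. by case: parityP => // w -> _; exists w. Qed.

Lemma oddP x : odd x -> exists w, x = 2 * w + 1.
Proof. by case: parityP => // w -> _; exists w. Qed.

Lemma odd_natr_ex x : odd x -> exists2 k, (k < 2 ^ (n - 1))%N & x = (2 * k + 1)%N%:R.
Proof.
move=> xo; have xlt : ((x : nat) < 2 ^ n)%N.
  by rewrite -[X in (_ < X)%N](Zp_cast modulus_gt1) ltn_ord.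
have e := odd_double_half x; rewrite xo in e.
exists (x : nat)./2; last by rewrite addnC mul2n e natr_Zp.
have := expnD 2 (n - 1) 1; rewrite subnK // => en; lia.
Qed.

(** Every element is a power of 2 times a unit; the bound on k lets it serve as
    an index of the families of conjugates. *)
Lemma val2_ex x :
  exists u k, [/\ (u <= n)%N, (k < 2 ^ (n - 1))%N & x = 2 ^+ u * (2 * k + 1)%N%:R].
Proof.
have [->|x0] := eqVneq x 0.
  by exists n, 0%N; rewrite pow2n0 mul0r expn_gt0.
have xpos : (0 < (x : nat))%N.
  by rewrite lt0n; apply: contra x0 => /eqP x0; apply/eqP/val_inj.
have [j nj ej] := pfactor_coprime (isT : prime 2) xpos.
have [|k kn jk] := @odd_natr_ex j%:R; first by rewrite odd_natr -coprime2n.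
exists (logn 2 x), k; split=> //.
  rewrite ltnW // -(ltn_exp2l _ _ (isT : 1 < 2)%N) (@leq_ltn_trans x) //.
    by rewrite dvdn_leq // pfactor_dvdnn.
  by rewrite -[X in (_ < X)%N](Zp_cast modulus_gt1) ltn_ord.
by rewrite -jk -natrX -natrM mulnC -ej natr_Zp.
Qed.

Lemma pow2_eq0 k : 2 ^+ k = 0 :> ZG n -> (n <= k)%N.
Proof. by rewrite -natrX => /natr_eq0; rewrite dvdn_Pexp2l. Qed.

Lemma pow2_unit_eq0 k x : odd x -> 2 ^+ k * x = 0 -> (n <= k)%N.
Proof.
rewrite -unitr_odd => xU /(congr1 (fun z => z * x^-1)).
by rewrite mul0r mulrK // => /pow2_eq0.
Qed.

Lemma val2_uniq u v x y : (u < n)%N -> (v < n)%N -> odd x -> odd y ->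
  2 ^+ u * x = 2 ^+ v * y -> u = v.
Proof.
wlog uv : u v x y / (u <= v)%N => [IH un vn xo yo E|un vn xo _ E].
  case/orP: (leq_total u v) => uv; first exact: (IH u v x y).
  by apply/esym/(IH v u y x).
have : 2 ^+ (n - v + u) * x = 0.
  by rewrite exprD -mulrA E mulrA -exprD subnK ?pow2n0 ?mul0r // ltnW.
by move/(pow2_unit_eq0 xo); lia.
Qed.

Lemma unit_mul_eq0 x y : odd x -> x * y = 0 -> y = 0.
Proof.
rewrite -unitr_odd => xU /(congr1 (fun z => x^-1 * z)).
by rewrite mulr0 mulKr.
Qed.

(** If z is 2^u times a unit, then z * z = 0 means n <= 2u: this is where the
    ceiling of n / 2 in the definition of H comes from. *)
Lemma sqr_eq0 z : z * z = 0 -> exists w, z = 2 ^+ uphalf n * w.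
Proof.
have [u [k [un _ ->]]] := val2_ex z; set c := (_ + 1)%N%:R => H.
have co : odd c by rewrite /c odd_natr oddD oddM.
have /(pow2_unit_eq0 co) nu : 2 ^+ (u + u) * c = 0.
  by apply: (@unit_mul_eq0 c) => //; rewrite -H exprD; ring.
exists (2 ^+ (u - uphalf n) * c); rewrite mulrA -exprD subnKC //.
by rewrite uphalfE; lia.
Qed.

End Arithmetic.

(** * The subgroups with coordinates d and s *)

Section TwoParameters.

Variable n : nat.

(** The two parity classes follow two affine rules, 1 + d x and 1 + s + d (x - 1);
    as x - odd x is even, d matters only through 2 d.  For s = d this is 1 + d x. *)
Definition slope (d s x : ZG n) : ZG n :=
  1 + d * (x - (odd x)%:R) + s * (odd x)%:R.

Definition slope_gamma (d s x : ZG n) : {perm ZG n} := sigma (slope d s x).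

Definition vertex (d s : ZG n) : {set {perm ZG n}} := subgroup_of (slope_gamma d s).

(** The two equations are the gamma equation for [slope d s] at (g, h) = (1, 2)
    and at (g, h) = (1, 1). *)
Definition admissible (d s : ZG n) : Prop :=
  [/\ odd d = false, odd s = false, 2 * d * (s - d) = 0 & (s - d) * (s + 2) = 0].

Hypothesis n_gt0 : (0 < n)%N.
Implicit Types (d s x y g h c : ZG n) (p q : {perm ZG n}).

Let oddrE := oddrE n_gt0.

Lemma slope_even d s w : slope d s (2 * w) = 1 + 2 * d * w.
Proof. by rewrite /slope !oddrE //=; ring. Qed.

Lemma slope_odd d s w : slope d s (2 * w + 1) = 1 + s + 2 * d * w.
Proof. by rewrite /slope !oddrE //=; ring. Qed.

Lemma odd_slope d s x : odd d = false -> odd s = false -> odd (slope d s x).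
Proof. by move=> d0 s0; rewrite /slope !oddrE d0 s0. Qed.

Lemma slope_unit d s x :
  odd d = false -> odd s = false -> slope d s x \is a GRing.unit.
Proof. by move=> d0 s0; rewrite unitr_odd // odd_slope. Qed.

Lemma slope1 d s : slope d s 1 = 1 + s.
Proof. by have := slope_odd d s 0; rewrite !mulr0 add0r addr0. Qed.

Lemma slope2 d s : slope d s 2 = 1 + 2 * d.
Proof. by have := slope_even d s 1; rewrite !mulr1. Qed.

(** On each of the four parity classes of (g, h) both sides are polynomials, and
    their difference is a combination of the two equations of [admissible]. *)
Lemma slopeM d s g h : admissible d s ->
  slope d s (slope d s h * g + h) = slope d s g * slope d s h.
Proof.
case=> /(evenP n_gt0)[d' ->] /(evenP n_gt0)[s' ->]; move: d s => _ _.
set d := 2 * d'; set s := 2 * s' => E1 E2.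
case: (parityP n_gt0 g) => g' ->; case: (parityP n_gt0 h) => h' ->.
- rewrite !slope_even (_ : _ + _ = 2 * ((1 + 2 * d * h') * g' + h')); last by ring.
  by rewrite slope_even; ring.
- rewrite slope_even slope_odd.
  rewrite (_ : _ + _ = 2 * ((1 + s + 2 * d * h') * g' + h') + 1); last by ring.
  by rewrite slope_odd; ring.
- rewrite slope_even slope_odd.
  rewrite (_ : _ + _ = 2 * (g' + 2 * d * h' * g' + d * h' + h') + 1); last by ring.
  by rewrite slope_odd; apply: (lincomb (c:=- h') E1); ring.
rewrite !slope_odd.
have -> : (1 + s + 2 * d * h') * (2 * g' + 1) + (2 * h' + 1) =
          2 * ((1 + s + 2 * d * h') * g' + s' + d * h' + h' + 1).
  by rewrite /s; ring.
rewrite slope_even; apply: (lincomb (c:=-h') E1); apply: (lincomb (c:=-1) E2).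
by rewrite /s; ring.
Qed.

Lemma sigmaM c c' : c \is a GRing.unit -> c' \is a GRing.unit ->
  sigma (c * c') = (sigma c * sigma c')%g.
Proof.
move=> cU c'U; apply/permP => x; rewrite permM !sigmaE ?unitrM ?cU //.
by rewrite mulrCA mulrA.
Qed.

Lemma slope_gamma_function d s : admissible d s -> gamma_function (slope_gamma d s).
Proof.
move=> A; have [d0 s0 _ _] := A; split=> [g|g h].
  exact/sigma_Aut/slope_unit.
by rewrite /slope_gamma sigmaE ?slope_unit // -sigmaM ?slope_unit // slopeM.
Qed.

Lemma admissible_vertex d s : admissible d s -> vertex d s \in vertices n.
Proof. by move/slope_gamma_function/subgroup_of_vertex. Qed.

Definition is_affine c g p := forall x, p x = c * x + g.

Lemma is_affine_mul c g c' g' p q :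
  is_affine c g p -> is_affine c' g' q -> is_affine (c * c') (c' * g + g') (p * q)%g.
Proof. by move=> Hp Hq x; rewrite permM Hp Hq; ring. Qed.

Lemma is_affine_conj c g c' g' p q :
  is_affine c g p -> is_affine c' g' q ->
  is_affine c (c' * g + g' - c * g') (p ^ q)%g.
Proof.
move=> Hp Hq x; rewrite -(permKV q x) permJ !Hq !Hp; ring.
Qed.

Lemma affine_slope d s g : odd d = false -> odd s = false ->
  is_affine (slope d s g) g (slope_gamma d s g * rho g)%g.
Proof. by move=> d0 s0 x; rewrite permM sigmaE ?slope_unit // permE. Qed.

(** An element of the group is determined by the image of 0, so membership of an
    affine permutation only depends on its slope. *)
Lemma mem_vertex d s c g p : odd d = false -> odd s = false ->
  is_affine c g p -> (p \in vertex d s) = (c == slope d s g).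
Proof.
move=> d0 s0 Hp; apply/imsetP/eqP => [[h _ ep]|ec].
  have Hq := affine_slope h d0 s0; rewrite -ep in Hq.
  have gh : g = h by have := Hp 0; rewrite Hq !mulr0 !add0r.
  have := Hp 1; rewrite Hq !mulr1 gh => /addIr; congruence.
exists g => //; apply/permP => x; rewrite Hp ec; exact/esym/affine_slope.
Qed.

Lemma mem_vertex_slope d s g : (slope_gamma d s g * rho g)%g \in vertex d s.
Proof. exact: imset_f. Qed.

Lemma vertex_eq d s d' s' : odd d = false -> odd s = false ->
  odd d' = false -> odd s' = false ->
  vertex d s = vertex d' s' <-> 2 * d = 2 * d' /\ s = s'.
Proof.
move=> d0 s0 d'0 s'0; split=> [E|[Ed <-]].
  have F g : slope d s g = slope d' s' g.
    have := mem_vertex_slope d s g.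
    rewrite E (mem_vertex d'0 s'0 (affine_slope g d0 s0)).
    by move/eqP.
  have := F 2; have := F 1; rewrite !slope1 !slope2.
  by move=> /addrI -> /addrI.
apply: eq_imset => g; rewrite /slope_gamma; congr (sigma _ * _)%g.
case: (parityP n_gt0 g) => w ->; by rewrite ?slope_even ?slope_odd Ed.
Qed.

(** Conjugating x |-> f'(h) x + h by x |-> f(g) x + g keeps the slope f'(h) and
    changes the image of 0 by an even amount; the conjugate lies in the second
    group when f' takes the same value at both images.  The pairs (g, h) = (2, 1)
    and (1, 1) give the two conditions, and the other pairs follow from these. *)
Lemma vertex_normP d s d' s' : admissible d s -> admissible d' s' ->
  reflect (2 * d' * (d - d') = 0 /\ d' * (s - s') = 0)
    (vertex d s \subset 'N(vertex d' s')).
Proof.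
move=> [d0 s0 _ _] [d'0 s'0 E _].
have conj_aff h g := is_affine_conj (affine_slope h d'0 s'0) (affine_slope g d0 s0).
have key : reflect (forall g h,
    slope d' s' h = slope d' s' (slope d s g * h + g - slope d' s' h * g))
    (vertex d s \subset 'N(vertex d' s')).
  apply: (iffP subsetP) => [H g h|H _ /imsetP[g _ ->]].
    have := H _ (mem_vertex_slope d s g); rewrite inE.
    move=> /subsetP/(_ ((slope_gamma d' s' h * rho h) ^ (slope_gamma d s g * rho g))%g).
    rewrite memJ_conjg => /(_ (mem_vertex_slope d' s' h)).
    by rewrite (mem_vertex d'0 s'0 (conj_aff h g)) => /eqP.
  rewrite inE; apply/subsetP => _ /imsetP[_ /imsetP[h _ ->] ->].
  by rewrite (mem_vertex d'0 s'0 (conj_aff h g)) -H.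
apply: (iffP key) => [H|[H1 H2] g h].
  have E1 := H 1 1; have E2 := H 2 1.
  rewrite !slope1 !slope2 in E1 E2.
  rewrite (_ : _ - _ = 2 * (d - s') + 1) ?slope_odd in E2; last by ring.
  have [s1 es] := evenP n_gt0 s0; have [s2 es'] := evenP n_gt0 s'0.
  rewrite (_ : _ - _ = 2 * (s1 - s2) + 1) ?slope_odd in E1; last first.
    by rewrite es es'; ring.
  split; first by apply: (lincomb (c:=-1) E2); apply: (lincomb (c:=1) E); ring.
  by apply: (lincomb (c:=-1) E1); rewrite es es'; ring.
have E3 : 2 * d' * (s - d') = 0.
  by apply: (lincomb (c:=2) H2); apply: (lincomb (c:=1) E); ring.
have E4 : 2 * d' * (d - s') = 0.
  by apply: (lincomb (c:=1) H1); apply: (lincomb (c:=-1) E); ring.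
have [s1 es] := evenP n_gt0 s0; have [s2 es'] := evenP n_gt0 s'0.
have := H2; rewrite es es' in E3 E4 *.
case: (parityP n_gt0 g) => g' ->; case: (parityP n_gt0 h) => h' ->;
  rewrite ?slope_even ?slope_odd => H3.
- rewrite (_ : _ - _ = 2 * (h' + 2 * (d - d') * g' * h')); last by ring.
  rewrite slope_even; apply: (lincomb (c:=- (2 * h' * g')) H1); ring.
- rewrite (_ : _ - _ = 2 * (h' + (d - 2 * s2) * g' + 2 * g' * h' * (d - d')) + 1);
    last by ring.
  rewrite slope_odd; apply: (lincomb (c:=- (2 * h' * g')) H1).
  apply: (lincomb (c:=- g') E4); ring.
- rewrite (_ : _ - _ = 2 * (h' + (2 * s1 - d') * h' + 2 * g' * h' * (d - d')));
    last by ring.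
  rewrite slope_even; apply: (lincomb (c:=- (2 * h' * g')) H1).
  apply: (lincomb (c:=- h') E3); ring.
rewrite (_ : _ - _ = 2 * (h' + (s1 - s2) + (2 * s1 - d') * h' +
                          (d - 2 * s2) * g' + 2 * g' * h' * (d - d')) + 1);
  last by ring.
rewrite slope_odd; apply: (lincomb (c:=- h') E3); apply: (lincomb (c:=-1) H3).
apply: (lincomb (c:=- (2 * h' * g')) H1); apply: (lincomb (c:=- g') E4); ring.
Qed.

Lemma edge_vertexP d s d' s' : admissible d s -> admissible d' s' ->
  reflect (vertex d s <> vertex d' s' /\
           [/\ 2 * d * (d - d') = 0, 2 * d' * (d - d') = 0,
               d * (s - s') = 0 & d' * (s - s') = 0])
    (edge (vertex d s) (vertex d' s')).
Proof.
move=> A A'; rewrite /edge !admissible_vertex //=; apply: (iffP and3P).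
  case=> /eqP ne /(vertex_normP A A')[H1 H2] /(vertex_normP A' A)[H3 H4]; split=> //.
  by split=> //; apply/eqP; rewrite -oppr_eq0 -mulrN opprB ?H3 ?H4.
case=> /eqP ne [H1 H2 H3 H4]; split=> //; first exact/(vertex_normP A A').
by apply/(vertex_normP A' A); split; apply/eqP; rewrite -oppr_eq0 -mulrN opprB ?H1 ?H3.
Qed.

End TwoParameters.

(** * Every regular subgroup of the holomorph has coordinates *)

Section Classification.

Variable n : nat.
Hypothesis n_gt1 : (1 < n)%N.
Implicit Types (c d s x y z g h : ZG n) (p q : {perm ZG n}).

Let n_gt0 : (0 < n)%N := ltnW n_gt1.
Let oddrE := oddrE n_gt0.

Lemma two_neq0 : 2 <> 0 :> ZG n.
Proof. by move/(@pow2_eq0 n n_gt0 1); rewrite leqNgt n_gt1. Qed.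

Section GammaEquation.

Variable f : ZG n -> ZG n.
Hypothesis f_odd : forall g, odd (f g).
Hypothesis fM : forall g h, f (f h * g + h) = f g * f h.
Hypothesis f_free : forall g x, f g * x + g = x -> g = 0.

(** If f 2 were 3 mod 4, then 1 - f 2 would be twice a unit and the map
    x |-> f 2 * x + 2 would have a fixed point. *)
Lemma gamma_f2 : exists2 d : ZG n, odd d = false & f 2 = 1 + 2 * d.
Proof.
have [d ed] := oddP n_gt0 (f_odd 2); exists d; last by rewrite ed addrC.
(* - d^-1 is the fixed point: (2 d + 1) (- d^-1) + 2 = - d^-1. *)
apply/negP => od; case: two_neq0; apply: (@f_free _ (- d^-1)); rewrite ed.
apply: (lincomb (c := -2) (mulVr (_ : d \is a GRing.unit))); last by ring.
by rewrite unitr_odd.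
Qed.

Variable d : ZG n.
Hypothesis d_even : odd d = false.
Hypothesis f2 : f 2 = 1 + 2 * d.

(** The even arguments at which f takes the value to be proved.  They are closed
    under the operation of x and y giving f y * x + y, which is the composition
    of permutations seen on the images of 0. *)
Let on_line x := odd x = false /\ f x = 1 + d * x.

Lemma on_line_circ x y : on_line x -> on_line y -> on_line (f y * x + y).
Proof.
move=> [x0 fx] [y0 fy]; split; first by rewrite !oddrE x0 y0 andbF.
by rewrite fM fx fy; ring.
Qed.

(** The square of x for this operation is (2 + d x) x, which has one more
    factor 2 than x when x is even. *)
Lemma on_line_pow2 m : exists2 c : ZG n, odd c & on_line (2 ^+ m.+1 * c).
Proof.
elim: m => [|m [c oc Tx]].
  exists 1; first exact: odd1r.
  by rewrite mulr1 expr1; split; rewrite ?f2; [apply: (odd_natr n_gt0 2)|ring].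
have [d' ed] := evenP n_gt0 d_even; have [_ fx] := Tx.
exists ((1 + d' * (2 ^+ m.+1 * c)) * c).
  by rewrite exprS -(mulrA 2) !oddrE oc andbF.
have := on_line_circ Tx Tx; rewrite fx.
by congr on_line; rewrite ed !exprS; ring.
Qed.

(** As [on_line] contains elements of every positive valuation, an approximation t
    of z can be corrected one binary digit at a time. *)
Lemma on_line_approx m z : odd z = false ->
  exists2 t, on_line t & exists w, z = t + 2 ^+ m.+1 * w.
Proof.
move=> z0; elim: m => [|m [t Tt [w ew]]].
  have [w ew] := evenP n_gt0 z0; exists 0; last by exists w; rewrite add0r expr1.
  (* f 0 is a unit equal to its square. *)
  split=> //; rewrite mulr0 addr0; have := fM 0 0; rewrite mulr0 addr0.
  move=> /(congr1 (fun x => x / f 0)); rewrite mulrK ?unitr_odd //.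
  by rewrite divrr ?unitr_odd.
case: (parityP n_gt0 w) ew => w' -> ew.
  by exists t => //; exists w'; rewrite ew (exprS _ m.+1); ring.
have [c oc Tc] := on_line_pow2 m.
exists (f t * (2 ^+ m.+1 * c) + t); first exact: on_line_circ.
have /(evenP n_gt0)[w2 e2] : odd (2 * w' + 1 - f t * c)%R = false.
  by rewrite !oddrE f_odd oc.
by exists w2; rewrite ew (exprS _ m.+1) [2 * _ * w2]mulrAC -e2; ring.
Qed.

Lemma f_even z : odd z = false -> f z = 1 + d * z.
Proof.
move=> /(on_line_approx n)[t [_ ft] [w ->]].
by rewrite exprS (pow2n0 n_gt0) mulr0 mul0r addr0.
Qed.

(** The odd elements are the f 1 * g + 1 with g even, where f is f g * f 1. *)
Lemma gamma_equation_slope : exists s, admissible d s /\ f =1 slope d s.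
Proof.
have f1U : f 1 \is a GRing.unit by rewrite unitr_odd.
have fE : f =1 slope d (f 1 - 1).
  move=> x; case: (parityP n_gt0 x) => w ->.
    by rewrite f_even ?slope_even ?oddrE //; ring.
  have e : 2 * w + 1 = f 1 * (2 * (w / f 1)) + 1.
    by rewrite mulrA [_ * 2]mulrC -mulrA [f 1 * _]mulrC divrK.
  rewrite {1}e fM f_even ?oddrE // slope_odd // addrC mulrDl.
  apply: (lincomb (c := 2 * d * w) (divrr f1U)); ring.
exists (f 1 - 1); split=> //.
have s0 : odd (f 1 - 1)%R = false by rewrite !oddrE f_odd.
split=> //.
  have := fM 1 2; rewrite f2 (fE (_ + _)).
  rewrite (_ : _ + 2 = 2 * (1 + d) + 1) ?(slope_odd n_gt0); last by ring.
  by move=> E; apply: (lincomb (c := -1) E); ring.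
have := fM 1 1; rewrite (fE (_ + _)) mulr1.
have [s es] := evenP n_gt0 s0.
rewrite (_ : f 1 = 2 * s + 1); last by rewrite -es; ring.
rewrite (_ : 2 * s + 1 + 1 = 2 * (s + 1)) ?(slope_even n_gt0); last by ring.
move=> E; apply: (lincomb (c := -1) E); ring.
Qed.

End GammaEquation.

Lemma Aut_linear p x : p \in Aut [set: ZG n] -> p x = p 1 * x.
Proof.
rewrite inE => /andP[_ /morphicP pM].
have pD y z : p (y + z) = p y + p z by apply: pM; rewrite inE.
have p0 : p 0 = 0 by apply: (addIr (p 0)); rewrite -pD !add0r.
have [m ->] := natr_ex x; elim: m => [|m IH]; first by rewrite mulr0.
by rewrite mulrSr pD IH mulrDr mulr1.
Qed.

(** The affine permutations form a group that contains the translations and the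
    automorphisms. *)
Lemma Hol_affine p : p \in Hol n -> is_affine (p 1 - p 0) (p 0) p.
Proof.
pose S := [set q : {perm ZG n} | [forall x, q x == (q 1 - q 0) * x + q 0]].
have SP q : reflect (is_affine (q 1 - q 0) (q 0) q) (q \in S).
  by rewrite inE; apply: (iffP forallP) => H x; apply/eqP/H.
have S_group : group_set S.
  apply/group_setP; split=> [|q r /SP Hq /SP Hr]; apply/SP => x.
    by rewrite !perm1; ring.
  have H := is_affine_mul Hq Hr; rewrite (H x) (H 1) (H 0); ring.
suff /subsetP HS : Hol n \subset Group S_group by move/HS/SP.
rewrite gen_subG; apply/subsetP => q /setUP[/imsetP[g _ ->]|qA].
  by apply/SP => x; rewrite !permE; ring.
by apply/SP => x; rewrite (Aut_linear x qA) (Aut_linear 0 qA); ring.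
Qed.

(** An even slope would give 0 and 2^(n-1) the same image. *)
Lemma affine_odd c g p : is_affine c g p -> odd c.
Proof.
move=> Hp; case: (parityP n_gt0 c) Hp => // w -> Hp.
have /(@perm_inj _ p) : p (2 ^+ n.-1) = p 0.
  by rewrite !Hp mulrAC -exprS prednK // (pow2n0 n_gt0) mul0r mulr0.
by move/(pow2_eq0 n_gt0); rewrite leqNgt prednK ?leqnn.
Qed.

(** By regularity exactly one element P g of N sends 0 to g; its slope f g satisfies
    the gamma equation because P g * P h sends 0 to f h * g + h. *)
Lemma vertices_admissible N :
  N \in vertices n -> exists d s, admissible d s /\ N = vertex d s.
Proof.
rewrite inE => /and3P[NG /subsetP NH /andP[trN /forallP freeN]].
pose G := Group NG.
have Naff p : p \in N -> is_affine (p 1 - p 0) (p 0) p by move/NH/Hol_affine.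
have Nfree p x : p \in N -> p x = x -> p = 1%g.
  move=> pN px; apply/set1gP; rewrite -(eqP (freeN x)) inE pN.
  exact/astab1P.
have Nex x : exists2 p, p \in N & p 0 = x.
  have : x \in orbit 'P G (0 : ZG n).
    by rewrite (atransP (trN : [transitive G, on _ | _])) inE.
  by case/orbitP => p pN <-; exists p.
have Ninj p q : p \in N -> q \in N -> p 0 = q 0 -> p = q.
  move=> pN qN e; apply/eqP; rewrite eq_mulgV1; apply/eqP/(@Nfree _ 0).
    exact: (groupM (pN : p \in G) (groupVr (qN : q \in G))).
  by rewrite permM e permK.
pose P x := odflt 1%g [pick p in N | p 0 == x].
have PN x : P x \in N /\ P x 0 = x.
  rewrite /P; case: pickP => [p /andP[-> /eqP]//|no].
  by have [p pN px] := Nex x; have := no p; rewrite pN px eqxx.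
pose f x := P x 1 - x.
have Pf x : is_affine (f x) x (P x).
  by have [/Naff H1 H2] := PN x; rewrite H2 in H1.
have f_odd x : odd (f x) := affine_odd (Pf x).
have fM g h : f (f h * g + h) = f g * f h.
  have Haff := is_affine_mul (Pf g) (Pf h).
  have E : (P g * P h)%g = P (f h * g + h).
    apply: Ninj; [|exact: (PN _).1|].
      exact: (groupM ((PN g).1 : _ \in G) (PN h).1).
    by rewrite (PN _).2 Haff mulr0 add0r.
  by rewrite {1}/f -E Haff; ring.
have f_free g x : f g * x + g = x -> g = 0.
  move=> H; have [PgN Pg0] := PN g.
  by have := @Nfree _ x PgN; rewrite Pf => /(_ H) E; rewrite -Pg0 E perm1.
have [d d0 f2] := gamma_f2 f_odd f_free.
have [s [A fE]] := gamma_equation_slope f_odd fM d0 f2.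
exists d, s; split=> //; apply/setP => p.
have [_ s0 _ _] := A; apply/idP/imsetP => [pN|[g _ ->]].
  exists (p 0) => //; rewrite (Ninj p (P (p 0)) pN (PN _).1) ?(PN _).2 //.
  by apply/permP => x; rewrite Pf fE affine_slope.
suff -> : (slope_gamma d s g * rho g)%g = P g by case: (PN g).
by apply/permP => x; rewrite Pf fE affine_slope.
Qed.

End Classification.

(** * Two kinds of families, and the coordinates of the named subgroups *)

Lemma vertex_congr n (d d' s s' : ZG n) : d = d' -> s = s' -> vertex d s = vertex d' s'.
Proof. by move=> -> ->. Qed.

Section NamedVertices.

Variable n : nat.
Hypothesis n_ge3 : (3 <= n)%N.
Implicit Types (c d s x y z w : ZG n).

Let n_gt0 : (0 < n)%N. Proof. by case: n n_ge3. Qed.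
Let oddrE := oddrE n_gt0.

Definition quarter : ZG n := 2 ^+ (n - 2).

Lemma quarter_mul4 : 4 * quarter = 0.
Proof. by rewrite -[4]/((2 * 2)%N%:R) natrM -expr2 -exprD subnKC ?pow2n0 // ltnW. Qed.

Lemma quarter_mul2 : 2 * quarter = 2 ^+ (n - 1).
Proof. by rewrite -exprS; congr (_ ^+ _); lia. Qed.

Lemma quarter_mul2_neq0 : 2 * quarter <> 0.
Proof. by rewrite quarter_mul2 => /(pow2_eq0 n_gt0); lia. Qed.

Lemma odd_quarter : odd quarter = false.
Proof. by rewrite /quarter (_ : n - 2 = (n - 3).+1)%N ?exprS ?oddrE //; lia. Qed.

Lemma mul2_eq0 x : 2 * x = 0 -> x = 0 \/ x = 2 * quarter.
Proof.
move=> H; have [|w ->] := (@pow2_mul_eq0 n n_gt0 1 x n_gt0).1; first by rewrite expr1.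
rewrite -quarter_mul2; case: (parityP n_gt0 w) => v ->; [left|right].
  by apply: (lincomb (c := v) quarter_mul4); ring.
by apply: (lincomb (c := v) quarter_mul4); ring.
Qed.

Lemma mul4_eq0 x : 4 * x = 0 -> 2 * x = 0 \/ 2 * x = 2 * quarter.
Proof. by move=> H; apply: mul2_eq0; rewrite -H; ring. Qed.

(** Up to equality of subgroups, the pairs (d', s') with 4 (d' - d) = 0 and
    2 (s' - s) = 0.  The set of N_3, ..., N_6 and the sets S_k have this form. *)
Definition quad d s : {set {set {perm ZG n}}} :=
  [set vertex d s; vertex d (s + 2 * quarter); vertex (d + quarter) s;
       vertex (d + quarter) (s + 2 * quarter)].

Let even_quarter d : odd d = false -> odd (d + quarter)%R = false.
Proof. by rewrite oddrE odd_quarter => ->. Qed.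

Let even_2quarter d : odd d = false -> odd (d + 2 * quarter)%R = false.
Proof. by rewrite oddDr // odd2r // => ->. Qed.

Lemma quadP d0 s0 N : odd d0 = false -> odd s0 = false ->
  N \in quad d0 s0 <-> exists d s,
    [/\ N = vertex d s, odd d = false, odd s = false,
        4 * (d - d0) = 0 & 2 * (s - s0) = 0].
Proof.
move=> ed0 es0; split=> [|[d [s [-> ed es Hd Hs]]]].
  rewrite !inE -!orbA => /or4P[] /eqP ->; do 2 eexists; split=> //;
    rewrite ?even_quarter ?even_2quarter ?subrr ?mulr0 //;
    by apply: (lincomb (c := 1) quarter_mul4); ring.
have eq_s s1 : odd s1 = false -> s = s1 -> forall d1, odd d1 = false ->
    2 * d = 2 * d1 -> vertex d s == vertex d1 s1.
  by move=> es1 E d1 ed1 E'; apply/eqP/(vertex_eq n_gt0).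
have [Es|Es] := mul2_eq0 Hs; have [Ed|Ed] := mul4_eq0 Hd; rewrite !inE.
- rewrite (eq_s s0) //; first by apply: (lincomb (c := 1) Es); ring.
  by apply: (lincomb (c := 1) Ed); ring.
- rewrite (eq_s s0 _ _ (d0 + quarter)) ?even_quarter ?orbT //.
    by apply: (lincomb (c := 1) Es); ring.
  by apply: (lincomb (c := 1) Ed); ring.
- rewrite (eq_s (s0 + 2 * quarter) _ _ d0) ?even_2quarter ?orbT //.
    by apply: (lincomb (c := 1) Es); ring.
  by apply: (lincomb (c := 1) Ed); ring.
rewrite (eq_s (s0 + 2 * quarter) _ _ (d0 + quarter));
  rewrite ?even_quarter ?even_2quarter ?orbT //.
  by apply: (lincomb (c := 1) Es); ring.
by apply: (lincomb (c := 1) Ed); ring.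
Qed.

Lemma mem_quad d0 s0 d s : odd d0 = false -> odd s0 = false ->
  odd d = false -> odd s = false ->
  vertex d s \in quad d0 s0 <-> 4 * (d - d0) = 0 /\ 2 * (s - s0) = 0.
Proof.
move=> ed0 es0 ed es; rewrite quadP //; split=> [[d' [s' [E ed' es' Hd Hs]]]|[Hd Hs]].
  have [E1 ->] := (vertex_eq n_gt0 ed es ed' es').1 E; split=> //.
  by apply: (lincomb (c := 1) Hd); apply: (lincomb (c := 2) E1); ring.
by exists d, s.
Qed.

Lemma card_quad d s : odd d = false -> odd s = false -> #|quad d s| = 4.
Proof.
move=> ed es.
have ne2 x : x = x + 2 * quarter -> False.
  by rewrite -{1}[x]addr0 => /addrI/esym/quarter_mul2_neq0.
have ned x : 2 * x = 2 * (x + quarter) -> False by rewrite mulrDr => /ne2.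
have e1 := even_quarter ed; have e2 := even_2quarter es.
rewrite /quad -!setUA !cardsU1 cards1 !inE.
by do 6!(rewrite (_ : (_ == _) = false); last by
  apply/eqP => /(vertex_eq n_gt0)[] // E1 E2; first [exact: ned E1|exact: ne2 E2]).
Qed.

(** The diagonal pairs (c', c') with c' = c mod 2^m.  The set H and the sets A_u^t
    have this form. *)
Definition ray c m : {set {set {perm ZG n}}} :=
  [set vertex (c + 2 ^+ m * w) (c + 2 ^+ m * w) | w : ZG n].

Lemma card_ray c m : odd c = false -> (0 < m <= n)%N ->
  #|ray c m| = (2 ^ (n - m))%N.
Proof.
move=> c0 /andP[m0 mn].
have ev w : odd (c + 2 ^+ m * w)%R = false.
  by rewrite -(prednK m0) exprS -mulrA oddDr // odd2r // c0.
pose F (i : 'I_(2 ^ (n - m))) := vertex (c + 2 ^+ m * i%:R) (c + 2 ^+ m * i%:R).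
have -> : ray c m = [set F i | i in 'I_(2 ^ (n - m))].
  apply/setP => N; apply/imsetP/imsetP => [[w _ ->]|[i _ ->]]; last by exists i%:R.
  have lt : ((w : nat) %% 2 ^ (n - m) < 2 ^ (n - m))%N by rewrite ltn_mod expn_gt0.
  exists (Ordinal lt) => //; rewrite /F /=; apply: vertex_congr; congr (_ + _);
    by rewrite -{1}[w]natr_Zp; apply/(pow2_mul_natr_eq n_gt0 _ _ mn); rewrite modn_mod.
rewrite card_imset ?card_ord // => i j /(vertex_eq n_gt0)[]// _.
move/addrI/(pow2_mul_natr_eq n_gt0 _ _ mn).
by rewrite !modn_small //; apply: val_inj.
Qed.

Lemma admissible_diag c : odd c = false -> admissible c c.
Proof. by split; rewrite ?subrr ?mulr0 ?mul0r. Qed.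

Lemma subgroup_of_slope (gamma : ZG n -> {perm ZG n}) d s :
  (forall x, gamma x = sigma (slope d s x)) -> subgroup_of gamma = vertex d s.
Proof. by move=> H; apply: eq_imset => x; rewrite H. Qed.

Lemma slope_diag c x : slope c c x = c * x + 1.
Proof. by rewrite /slope; ring. Qed.

Lemma subgroup_of_gamma_c u k :
  subgroup_of (gamma_pow (@gamma_c n u) k) =
  vertex (2 ^+ u * (2 * k + 1)%N%:R) (2 ^+ u * (2 * k + 1)%N%:R).
Proof. by apply: subgroup_of_slope => x; rewrite slope_diag -mulrA. Qed.

Lemma subgroup_of_gamma_p k :
  subgroup_of (gamma_pow (@gamma_p n) k) =
  vertex (2 * (2 * k + 1)%N%:R) (2 * (2 * k + 1)%N%:R).
Proof. by apply: subgroup_of_slope => x; rewrite slope_diag -mulrA. Qed.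

Lemma subgroup_of_gamma_m k :
  subgroup_of (gamma_pow (@gamma_m n) k) =
  vertex (2 * (2 * k + 1)%N%:R) (2 * (2 * k + 1)%N%:R + quarter).
Proof.
apply: subgroup_of_slope => x; rewrite /gamma_pow /gamma_m oddMr // odd_natr //.
rewrite oddD oddM /= /slope -/quarter.
by case: (odd x); congr sigma; rewrite /=; ring.
Qed.

Lemma sigmaX c m : c \is a GRing.unit -> (sigma c ^+ m)%g = sigma (c ^+ m).
Proof.
move=> cU; elim: m => [|m IH].
  by apply/permP => x; rewrite expg0 expr0 sigmaE ?unitr1 // perm1 mul1r.
by rewrite expgS exprS IH sigmaM ?unitrX.
Qed.

(** Common form of gamma_2, gamma_3 and gamma_4: c ^+ x depends only on the parity
    of x. *)
Lemma subgroup_of_involution c : odd c -> c * c = 1 ->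
  subgroup_of (fun x : ZG n => (sigma c ^+ (x : nat))%g) = vertex 0 (c - 1).
Proof.
move=> co cc; apply: subgroup_of_slope => x; rewrite sigmaX ?unitr_odd //.
rewrite -{1}(odd_double_half x) exprD -muln2 mulnC exprM expr2 cc expr1n mulr1.
by rewrite /slope; case: (odd x); congr sigma; rewrite /=; ring.
Qed.

Lemma half_modulus : (2 ^ (n - 1))%N%:R = 2 * quarter :> ZG n.
Proof. by rewrite natrX quarter_mul2. Qed.

Lemma half_add1 : (2 ^ (n - 1) + 1)%N%:R = 2 * quarter + 1 :> ZG n.
Proof. by rewrite natrD half_modulus. Qed.

Lemma half_sub1 : (2 ^ (n - 1) - 1)%N%:R = 2 * quarter - 1 :> ZG n.
Proof. by rewrite natrB ?expn_gt0 // half_modulus. Qed.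

Lemma full_sub1 : (2 ^ n - 1)%N%:R = - 1 :> ZG n.
Proof. by rewrite natrB ?expn_gt0 // natrX pow2n0 // sub0r. Qed.

Lemma N1E : N1 n = vertex 0 0.
Proof. by apply: subgroup_of_slope => x; rewrite slope_diag mul0r add0r. Qed.

Lemma N2E : N2 n = vertex (2 * quarter) (2 * quarter).
Proof.
rewrite /N2 /gamma2 half_add1 subgroup_of_involution ?oddrE //.
  apply/(vertex_eq n_gt0); rewrite ?oddrE //; split; last by ring.
  by apply: (lincomb (c := -1) quarter_mul4); ring.
by apply: (lincomb (c := quarter + 1) quarter_mul4); ring.
Qed.

Lemma N3E : N3 n = vertex 0 (2 * quarter - 2).
Proof.
rewrite /N3 /gamma3 half_sub1 subgroup_of_involution ?oddrE //.
  by apply: vertex_congr; ring.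
by apply: (lincomb (c := quarter - 1) quarter_mul4); ring.
Qed.

Lemma N4E : N4 n = vertex 0 (- 2).
Proof.
rewrite /N4 /gamma4 full_sub1 subgroup_of_involution ?oddrE //; last by ring.
by apply: vertex_congr; ring.
Qed.

(** Common form of gamma_5 and gamma_6. *)
Lemma subgroup_of_residues4 c1 c3 : c3 = c1 + 2 * quarter ->
  subgroup_of (fun x : ZG n => match (x %% 4)%N with
    | 0 => sigma 1 | 1 => sigma c1 | 2 => sigma (2 * quarter + 1) | _ => sigma c3 end)
  = vertex quarter (c1 - 1).
Proof.
move=> ->; apply: subgroup_of_slope => x; have E := quarter_mul4.
have := divn_eq x 4; have := ltn_pmod x (isT : 0 < 4)%N.
move: (x %% 4)%N (x %/ 4)%N => r j r4 /(congr1 (fun m => m%:R : ZG n)).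
rewrite natr_Zp natrD natrM mulrC => ->.
case: r r4 => [|[|[|[|//]]]] _; congr sigma.
- rewrite [X in slope _ _ X](_ : _ = 2 * (2 * j%:R)) ?(slope_even n_gt0); last by ring.
  by apply: (lincomb (c := - j%:R) E); ring.
- rewrite [X in slope _ _ X](_ : _ = 2 * (2 * j%:R) + 1) ?(slope_odd n_gt0); last by ring.
  by apply: (lincomb (c := - j%:R) E); ring.
- rewrite [X in slope _ _ X](_ : _ = 2 * (2 * j%:R + 1)) ?(slope_even n_gt0); last by ring.
  by apply: (lincomb (c := - j%:R) E); ring.
rewrite [X in slope _ _ X](_ : _ = 2 * (2 * j%:R + 1) + 1) ?(slope_odd n_gt0); last by ring.
by apply: (lincomb (c := - j%:R) E); ring.
Qed.

Lemma N5E : N5 n = vertex quarter (2 * quarter - 2).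
Proof.
rewrite /N5 /gamma5 half_sub1 half_add1 full_sub1 subgroup_of_residues4.
  by apply: vertex_congr; ring.
by apply: (lincomb (c := -1) quarter_mul4); ring.
Qed.

Lemma N6E : N6 n = vertex quarter (- 2).
Proof.
rewrite /N6 /gamma6 half_sub1 half_add1 full_sub1 subgroup_of_residues4; last by ring.
by apply: vertex_congr; ring.
Qed.

End NamedVertices.

Section Blocks.

Variable n : nat.
Hypothesis n_ge3 : (3 <= n)%N.
Implicit Types (c d s x y z w : ZG n) (N M : {set {perm ZG n}}).

Let n_gt0 : (0 < n)%N. Proof. by case: n n_ge3. Qed.
Let oddrE := oddrE n_gt0.

Lemma natr_odd k : (2 * k + 1)%N%:R = 2 * k%:R + 1 :> ZG n.
Proof. by rewrite natrD natrM. Qed.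

(** The exponent u = n accounts for 0, and the other multiples of 2^ceil(n/2) are
    2^u times a unit with ceil(n/2) <= u < n. *)
Lemma Hset_ray : Hset n = ray (0 : ZG n) (uphalf n).
Proof.
apply/setP => N; apply/bigcupP/imsetP => [[u hu /imsetP[k _ ->]]|[w _ ->]].
  exists (2 ^+ (u - uphalf n) * (2 * k + 1)%N%:R) => //.
  by rewrite mulrA -exprD subnKC // add0r subgroup_of_gamma_c //; lia.
rewrite add0r; have [u [k [un kn E]]] := val2_ex n_gt0 (2 ^+ uphalf n * w).
have hu : (uphalf n <= u)%N.
  have o : odd ((2 * k + 1)%N%:R : ZG n) by rewrite odd_natr // oddD oddM.
  have : 2 ^+ (n - uphalf n + u) * (2 * k + 1)%N%:R = 0 :> ZG n.
    by rewrite exprD -mulrA -E mulrA -exprD subnK ?pow2n0 ?mul0r //; lia.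
  by move/(pow2_unit_eq0 n_gt0 o); lia.
have un' : (u < n.+1)%N by [].
exists (Ordinal un') => //; apply/imsetP; exists (Ordinal kn) => //.
by rewrite E subgroup_of_gamma_c //=; lia.
Qed.

(** Multiplied by 2^(u+1), the congruence k = t mod 2^(n-2u-1) becomes a congruence
    of 2^u (2k+1) and 2^u (2t+1) modulo 2^(n-u). *)
Lemma Aset_ray u t : (2 <= u)%N -> (2 * u < n)%N ->
  Aset n u t = ray (2 ^+ u * (2 * t + 1)%N%:R : ZG n) (n - u).
Proof.
move=> u2 un; set D := (n - 2 * u - 1)%N.
have eD : 2 ^+ (n - u) = 2 ^+ u * (2 * 2 ^+ D) :> ZG n.
  by rewrite -exprS -exprD; congr (_ ^+ _); rewrite /D; lia.
apply/setP => N; apply/imsetP/imsetP => [[k]|[w _ ->]].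
  rewrite inE => /eqP kt ->; rewrite subgroup_of_gamma_c //.
  exists ((k %/ 2 ^ D)%:R - (t %/ 2 ^ D)%:R) => //; rewrite eD.
  set j := (X in 2 ^+ u * (2 * 2 ^+ D) * X).
  have e : k%:R = t%:R + 2 ^+ D * j.
    rewrite {1}(divn_eq k (2 ^ D)) {1}(divn_eq t (2 ^ D)) -/D kt /j.
    by rewrite !(natrD, natrM, natrX); ring.
  by apply: vertex_congr; rewrite !natr_odd e; ring.
have o : odd ((2 * t + 1)%N%:R + 2 * 2 ^+ D * w)%R.
  by rewrite -mulrA oddDr // odd2r // odd_natr // oddD oddM.
have [k kn ek] := odd_natr_ex n_gt0 o.
exists (Ordinal kn) => /=; last first.
  by rewrite subgroup_of_gamma_c eD -ek; apply: vertex_congr; ring.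
rewrite inE /= -/D; move: ek; have [j ->] := natr_ex w.
rewrite -natrX -!natrM -natrD => /(natr_eq_mod n_gt0)/esym E.
have : (2 * k + 1 = 2 * t + 1 %[mod 2 * 2 ^ D])%N.
  have dv : (2 * 2 ^ D %| 2 ^ n)%N by rewrite -expnS dvdn_Pexp2l // /D; lia.
  rewrite -(modn_dvdm (2 * k + 1) dv) E modn_dvdm // addnC.
  by rewrite [(2 * 2 ^ D * _)%N]mulnC modnMDl.
by move/eqP; rewrite eqn_modDr -!muln_modr eqn_pmul2l.
Qed.

(** The four indices shift d by 0, 1, 2 and 3 quarters, and gamma_m adds one more
    quarter to s; shifting d by two quarters does not change the group. *)
Lemma Sset_quad k : (4 <= n)%N ->
  Sset n k = quad (2 * (2 * k + 1)%N%:R : ZG n) (2 * (2 * k + 1)%N%:R).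
Proof.
move=> n4; have E := quarter_mul4 n_ge3; set c : ZG n := (2 * k + 1)%N%:R.
have e4 : 4 * 2 ^+ (n - 4) = quarter n.
  rewrite -[4]/((2 * 2)%N%:R) natrM -mulrA -!exprS; congr (_ ^+ _); lia.
have e3 : 2 * 2 ^+ (n - 3) = quarter n by rewrite -exprS; congr (_ ^+ _); lia.
have oq := odd_quarter n_ge3.
have c1 : 2 * (2 * (k + 2 ^ (n - 4)) + 1)%N%:R = 2 * c + 1 * quarter n.
  by rewrite /c !natr_odd natrD natrX -e4; ring.
have c2 : 2 * (2 * (k + 2 ^ (n - 3)) + 1)%N%:R = 2 * c + 2 * quarter n.
  by rewrite /c !natr_odd natrD natrX -e3; ring.
have c3 : 2 * (2 * (k + 2 ^ (n - 3) + 2 ^ (n - 4)) + 1)%N%:R = 2 * c + 3 * quarter n.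
  have -> : 3 * quarter n = 2 * quarter n + quarter n by ring.
  by rewrite /c !natr_odd !natrD !natrX -{1}e3 -e4; ring.
rewrite /Sset !subgroup_of_gamma_p !subgroup_of_gamma_m // c1 c2 c3 -/c.
have -> : vertex (2 * c + 1 * quarter n) (2 * c + 1 * quarter n + quarter n)
          = vertex (2 * c + quarter n) (2 * c + 2 * quarter n).
  by apply: vertex_congr; ring.
have -> : vertex (2 * c + 2 * quarter n) (2 * c + 2 * quarter n)
          = vertex (2 * c) (2 * c + 2 * quarter n).
  apply/(vertex_eq n_gt0); rewrite ?oddrE ?oq ?andbF //; split=> //.
  by apply: (lincomb (c := 1) E); ring.
have -> : vertex (2 * c + 3 * quarter n) (2 * c + 3 * quarter n + quarter n)
          = vertex (2 * c + quarter n) (2 * c).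
  apply/(vertex_eq n_gt0); rewrite ?oddrE ?oq ?andbF //; split;
    by apply: (lincomb (c := 1) E); ring.
by apply/setP=> N; rewrite !inE; do 4!case: (N == _).
Qed.

End Blocks.

(** * The two types of vertices *)

Section Components.

Variable n : nat.
Hypothesis n_ge3 : (3 <= n)%N.
Implicit Types (c d s x y z w : ZG n) (N M : {set {perm ZG n}}).

Let n_gt0 : (0 < n)%N. Proof. by case: n n_ge3. Qed.
Let oddrE := oddrE n_gt0.

Lemma edge_sym : symmetric (@edge n).
Proof.
move=> N M; rewrite /edge (eq_sym M).
by do 2!case: (_ \in vertices n) => //=; case: (N != M) => //=; rewrite andbC.
Qed.

(** Here s + 2 is twice a unit, so the second equation says 2 (s - d) = 0. *)
Lemma admissible_mod4_0 d s' : odd s' = false -> admissible d (2 * s') ->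
  vertex d (2 * s') = vertex (2 * s') (2 * s').
Proof.
move=> es [ed e2 _ H].
apply/(vertex_eq n_gt0) => //; split=> //.
have o : odd (s' + 1)%R by rewrite !oddrE es.
have E : 2 * (2 * s' - d) = 0.
  by apply: (unit_mul_eq0 n_gt0 o); rewrite -H; ring.
by apply: (lincomb (c := -1) E); ring.
Qed.

(** Here s - d is twice a unit, and both equations can be divided by it. *)
Lemma admissible_mod4_2 d s' : odd s' -> admissible (2 * d) (2 * s') -> odd d = false ->
  vertex (2 * d) (2 * s') \in quad 0 (- 2).
Proof.
move=> os [_ _ H1 H2] ed; apply/(mem_quad n_ge3); rewrite ?oddrE //.
have o : odd (s' - d)%R by rewrite !oddrE os ed.
by split; apply: (unit_mul_eq0 n_gt0 o);
  [apply: (lincomb (c := 1) H1)|apply: (lincomb (c := 1) H2)]; ring.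
Qed.

Definition S_block (k : nat) : {set {set {perm ZG n}}} :=
  quad (2 * (2 * k + 1)%N%:R : ZG n) (2 * (2 * k + 1)%N%:R).

(** If d is twice a unit, the first equation says 4 d = 4 s, and s is 2 (2k+1), where
    only k mod 2^(n-3) matters.  If moreover n = 3, then 8 = 0 and the group falls
    into the first alternative. *)
Lemma admissible_mod4_2P d s' : odd s' -> admissible d (2 * s') ->
  vertex d (2 * s') \in quad 0 (- 2) \/
  (4 <= n)%N /\ exists2 k, (k < 2 ^ (n - 3))%N & vertex d (2 * s') \in S_block k.
Proof.
move=> os A; have [ed _ H1 H2] := A.
have [d' e] := evenP n_gt0 ed; rewrite e in A H1 H2 *.
case od : (odd d'); last by left; apply: admissible_mod4_2.
have [n3|n4] := leqP n 3.
  have E : 8 = 0 :> ZG n.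
    have -> : 8 = 2 ^+ n :> ZG n by rewrite (_ : n = 3) -?natrX //; lia.
    exact: pow2n0.
  left; apply/(mem_quad n_ge3); rewrite ?oddrE //.
  have [s'' ->] := oddP n_gt0 os.
  by split; [apply: (lincomb (c := d') E)|apply: (lincomb (c := s'' + 1) E)]; ring.
right; split=> //; have [k kn ek] := odd_natr_ex n_gt0 os.
exists (k %% 2 ^ (n - 3))%N; first by rewrite ltn_mod expn_gt0.
have E4 : 4 * (2 * s' - 2 * d') = 0.
  by apply: (unit_mul_eq0 n_gt0 od); rewrite -H1; ring.
have E : 2 ^+ 3 * k%:R = 2 ^+ 3 * (k %% 2 ^ (n - 3))%:R :> ZG n.
  by apply/(pow2_mul_natr_eq n_gt0 _ _ n_ge3); rewrite modn_mod.
apply/(mem_quad n_ge3); rewrite ?oddrE // ek !natr_odd.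
rewrite ek natr_odd in E4.
split; last by apply: (lincomb (c := 1) E); ring.
by apply: (lincomb (c := - 1) E4); apply: (lincomb (c := 2) E); ring.
Qed.

Lemma admissible_quad_E d s : odd d = false -> odd s = false ->
  4 * (d - 0) = 0 -> 2 * (s - - 2) = 0 -> admissible d s.
Proof.
move=> ed es Hd Hs; split=> //;
  have [d' e] := evenP n_gt0 ed; have [s' e'] := evenP n_gt0 es.
  by rewrite e e' in Hd Hs *; apply: (lincomb (c := s' - d') Hd); ring.
by rewrite e e' in Hd Hs *; apply: (lincomb (c := s' - d') Hs); ring.
Qed.

(** The difference d - 2 c is a multiple of the quarter, hence of 4 as n >= 4. *)
Lemma S_block_2mod4 c d : (4 <= n)%N -> odd c -> 4 * (d - 2 * c) = 0 ->
  exists2 c' : ZG n, odd c' & d = 2 * c'.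
Proof.
move=> n4 oc; rewrite -[4]/((2 * 2)%N%:R) natrM.
have le2 : (2 <= n)%N by lia.
move/(@pow2_mul_eq0 n n_gt0 2 _ le2).1 => [w H].
exists (c + 2 ^+ (n - 3) * w).
  by rewrite !oddrE oc (_ : n - 3 = (n - 4).+1)%N ?exprS -?mulrA ?oddrE //; lia.
apply: (lincomb (c := 1) H); rewrite (_ : n - 2 = (n - 3).+1)%N ?exprS; last by lia.
by ring.
Qed.

Lemma admissible_quad_S c d s : odd c -> odd d = false -> odd s = false ->
  4 * (d - 2 * c) = 0 -> 2 * (s - 2 * c) = 0 -> admissible d s.
Proof.
move=> oc ed es Hd Hs; split=> //.
  have [d' e] := evenP n_gt0 ed; rewrite e in Hd *.
  by apply: (lincomb (c := - d') Hd); apply: (lincomb (c := 2 * d') Hs); ring.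
have [c' e] := oddP n_gt0 oc; have [s' e'] := evenP n_gt0 es.
have [w ew] : exists w, d = 2 * c + quarter n * w.
  have le2 : (2 <= n)%N by lia.
  have [|w H] := (@pow2_mul_eq0 n n_gt0 2 (d - 2 * c) le2).1.
    by rewrite -Hd -natrX.
  by exists w; apply: (lincomb (c := 1) H); rewrite /quarter; ring.
have [q' eq'] := evenP n_gt0 (odd_quarter n_ge3).
have E := quarter_mul4 n_ge3.
have -> : s = 2 * c + (s - 2 * c) by ring.
have [->|->] := mul2_eq0 n_ge3 Hs.
  by rewrite ew e; apply: (lincomb (c := - w * (c' + 1)) E); ring.
(* 2 quarter^2 = 0 because the quarter is even. *)
rewrite ew e; apply: (lincomb (c := (2 - w) * 2 * quarter n) eq').
by apply: (lincomb (c := (2 - w) * (c' + 1 + q')) E); ring.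
Qed.

End Components.

(** * Edges inside the blocks and edges leaving them *)

Section Closure.

Variable n : nat.
Hypothesis n_ge3 : (3 <= n)%N.
Implicit Types (c d s x y z w : ZG n) (N M : {set {perm ZG n}}).

Let n_gt0 : (0 < n)%N. Proof. by case: n n_ge3. Qed.
Let n_gt1 : (1 < n)%N. Proof. by case: n n_ge3 => [|[]]. Qed.
Let oddrE := oddrE n_gt0.

Definition E_block : {set {set {perm ZG n}}} := quad 0 (- 2).
Definition H_block : {set {set {perm ZG n}}} := ray 0 (uphalf n).
Definition A_block (u t : nat) : {set {set {perm ZG n}}} :=
  ray (2 ^+ u * (2 * t + 1)%N%:R) (n - u).

Lemma vertices_mod4 N : N \in vertices n ->
  (exists s, odd s = false /\ N = vertex (2 * s) (2 * s)) \/
  (exists d s, [/\ odd s, admissible d (2 * s) & N = vertex d (2 * s)]).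
Proof.
move=> /(vertices_admissible n_gt1)[d [s [A ->]]]; have [_ es _ _] := A.
have [s' e] := evenP n_gt0 es; rewrite e in A *.
case o : (odd s'); [right|left]; first by exists d, s'.
by exists s'; rewrite (admissible_mod4_0 n_ge3 o A).
Qed.

Lemma edge_diag c c' : odd c = false -> odd c' = false ->
  edge (vertex c c) (vertex c' c') <->
  [/\ c <> c', c * (c - c') = 0 & c' * (c - c') = 0].
Proof.
move=> ec ec'; have P := edge_vertexP n_gt0 (admissible_diag ec) (admissible_diag ec').
split=> [/P[ne [_ _ H H']]|[ne H H']].
  by split=> // E; apply: ne; rewrite E.
apply/P; split.
  by move/(vertex_eq n_gt0 ec ec ec' ec') => [].
by split=> //; rewrite -mulrA ?H ?H' mulr0.
Qed.

(** The difference 2 c - 2 s of the second coordinates is twice a unit, so the last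
    two equations of [edge_vertexP] say 2 (2 c) = 0 and 2 d = 0; the other two
    then hold. *)
Lemma edge_mixed c d s : odd c = false -> odd s -> admissible d (2 * s) ->
  edge (vertex (2 * c) (2 * c)) (vertex d (2 * s)) <-> 2 * (2 * c) = 0 /\ 2 * d = 0.
Proof.
move=> ec os A; have [ed _ _ _] := A.
have e2c := odd2r n_gt0 c; have e2s := odd2r n_gt0 s.
have o : odd (c - s)%R by rewrite !oddrE ec os.
split=> [/(edge_vertexP n_gt0 (admissible_diag e2c) A)[_ [_ _ H1 H2]]|[H1 H2]].
  by split; apply: (unit_mul_eq0 n_gt0 o);
    [apply: (lincomb (c := 1) H1)|apply: (lincomb (c := 1) H2)]; ring.
apply/(edge_vertexP n_gt0 (admissible_diag e2c) A); split.
  move/(vertex_eq n_gt0 e2c e2c ed e2s) => [_ E]; case: (two_neq0 n_gt1).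
  by apply: (unit_mul_eq0 n_gt0 o); rewrite mulrC mulrBr E subrr.
split.
- by apply: (lincomb (c := 2 * c - d) H1); ring.
- by apply: (lincomb (c := 2 * c - d) H2); ring.
- by apply: (lincomb (c := c - s) H1); ring.
by apply: (lincomb (c := c - s) H2); ring.
Qed.

Lemma mem_ray_odd c m N : odd c = false -> (0 < m)%N -> N \in ray c m ->
  exists d, [/\ odd d = false, N = vertex d d & exists w, d = c + 2 ^+ m * w].
Proof.
move=> ec m0 /imsetP[w _ ->]; exists (c + 2 ^+ m * w); split=> //; last by exists w.
by rewrite oddDr // -(prednK m0) exprS -mulrA odd2r // ec.
Qed.

Lemma mem_ray c m w : vertex (c + 2 ^+ m * w) (c + 2 ^+ m * w) \in ray c m.
Proof. exact: imset_f. Qed.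

Lemma ray_vertices c m : odd c = false -> (0 < m)%N -> ray c m \subset vertices n.
Proof.
move=> ec m0; apply/subsetP => N /(mem_ray_odd ec m0)[d [ed -> _]].
exact/(admissible_vertex n_gt0)/admissible_diag.
Qed.

Lemma ray_clique c m : odd c = false -> (0 < m)%N -> 2 ^+ m * c = 0 ->
  (n <= m + m)%N -> clique (ray c m).
Proof.
move=> ec m0 H nm N M /(mem_ray_odd ec m0)[d [ed -> [w ew]]].
move=> /(mem_ray_odd ec m0)[d' [ed' -> [w' ew']]] ne.
have mm : 2 ^+ m * 2 ^+ m = 0 :> ZG n.
  by rewrite -exprD -(subnK nm) exprD pow2n0 // mulr0.
apply/(edge_diag ed ed'); split; first by move=> E; rewrite E eqxx in ne.
  rewrite ew ew'; apply: (lincomb (c := w - w') H).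
  by apply: (lincomb (c := w * (w - w')) mm); ring.
rewrite ew ew'; apply: (lincomb (c := w - w') H).
by apply: (lincomb (c := w' * (w - w')) mm); ring.
Qed.

(** The four equations of [edge_vertexP] hold since d and d' are even. *)
Lemma quad_edge d s d' s' d0 s0 :
  admissible d s -> admissible d' s' -> vertex d s <> vertex d' s' ->
  4 * (d - d0) = 0 -> 2 * (s - s0) = 0 ->
  4 * (d' - d0) = 0 -> 2 * (s' - s0) = 0 -> edge (vertex d s) (vertex d' s').
Proof.
move=> A A' ne Hd Hs Hd' Hs'; apply/(edge_vertexP n_gt0 A A'); split=> //.
have [ed _ _ _] := A; have [ed' _ _ _] := A'.
have [e eE] := evenP n_gt0 ed; have [e' eE'] := evenP n_gt0 ed'.
rewrite eE eE' in Hd Hd' *; split.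
- by apply: (lincomb (c := e) Hd); apply: (lincomb (c := - e) Hd'); ring.
- by apply: (lincomb (c := e') Hd); apply: (lincomb (c := - e') Hd'); ring.
- by apply: (lincomb (c := e) Hs); apply: (lincomb (c := - e) Hs'); ring.
by apply: (lincomb (c := e') Hs); apply: (lincomb (c := - e') Hs'); ring.
Qed.

Let even_m2 : odd (- 2 : ZG n)%R = false.
Proof. by rewrite !oddrE. Qed.

Lemma E_blockP N : N \in E_block -> exists d s,
  [/\ N = vertex d (2 * s), odd s, admissible d (2 * s), 4 * d = 0
    & 2 * (2 * s + 2) = 0].
Proof.
have e0 : odd (0 : ZG n)%R = false by [].
move/(quadP n_ge3 N e0 even_m2).1 => [d [s [-> ed es Hd Hs]]].
have A := admissible_quad_E n_ge3 ed es Hd Hs.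
have [s' e] := evenP n_gt0 es; rewrite e in A Hs *.
rewrite subr0 opprK in Hd Hs; exists d, s'; split=> //.
case: parityP Hs => // w -> H.
have o : odd (2 * w + 1 : ZG n)%R by rewrite !oddrE.
have : (2 ^+ 2 : ZG n) = 0.
  by apply: (unit_mul_eq0 n_gt0 o); rewrite -H; ring.
by move/(pow2_eq0 n_gt0); lia.
Qed.

Lemma E_vertices : E_block \subset vertices n.
Proof.
by apply/subsetP => N /E_blockP[d [s [-> _ A _ _]]]; apply: admissible_vertex.
Qed.

Lemma E_clique : clique E_block.
Proof.
move=> N M /E_blockP[d [s [-> _ A Hd Hs]]] /E_blockP[d' [s' [-> _ A' Hd' Hs']]] ne.
by apply: (@quad_edge _ _ _ _ 0 (-2)) => //; rewrite ?subr0 ?opprK //; apply/eqP.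
Qed.

Lemma S_blockP c N : odd c -> N \in quad (2 * c) (2 * c) -> exists d s,
  [/\ N = vertex d s, admissible d s, 4 * (d - 2 * c) = 0 & 2 * (s - 2 * c) = 0].
Proof.
move=> oc; have e2 := odd2r n_gt0 c.
move/(quadP n_ge3 N e2 e2).1 => [d [s [-> ed es Hd Hs]]].
by exists d, s; split=> //; apply: admissible_quad_S Hd Hs.
Qed.

Lemma odd_natr_odd k : odd ((2 * k + 1)%N%:R : ZG n).
Proof. by rewrite odd_natr // oddD oddM. Qed.

Lemma S_vertices k : S_block n k \subset vertices n.
Proof.
apply/subsetP => N /(S_blockP (odd_natr_odd k))[d [s [-> A _ _]]].
exact: admissible_vertex.
Qed.

Lemma S_clique k : clique (S_block n k).
Proof.
move=> N M /(S_blockP (odd_natr_odd k))[d [s [-> A Hd Hs]]].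
move=> /(S_blockP (odd_natr_odd k))[d' [s' [-> A' Hd' Hs']]] ne.
by apply: (quad_edge A A' _ Hd Hs Hd' Hs'); apply/eqP.
Qed.

(** As d is twice a unit, the two edge equations with factor d say 4 (d - d') = 0
    and 2 (s - s') = 0. *)
Lemma S_closed k N M : (4 <= n)%N -> N \in S_block n k -> edge N M -> M \in S_block n k.
Proof.
move=> n4 /(S_blockP (odd_natr_odd k))[d [s [-> A Hd Hs]]] E.
have MV : M \in vertices n by case/and5P: E.
have [d' [s' [A' eM]]] := vertices_admissible n_gt1 MV; rewrite eM in E *.
have [_ [H1 _ H2 _]] := edge_vertexP n_gt0 A A' E.
have [c oc ec] := S_block_2mod4 n_ge3 n4 (odd_natr_odd k) Hd.
have [ed' es' _ _] := A'.
apply/(mem_quad n_ge3); rewrite ?oddrE //.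
have H1' : 4 * (d - d') = 0.
  by apply: (unit_mul_eq0 n_gt0 oc); rewrite -H1 ec; ring.
have H2' : 2 * (s - s') = 0.
  by apply: (unit_mul_eq0 n_gt0 oc); rewrite -H2 ec; ring.
split; first by apply: (lincomb (c := 1) Hd); apply: (lincomb (c := -1) H1'); ring.
by apply: (lincomb (c := 1) Hs); apply: (lincomb (c := -1) H2'); ring.
Qed.

(** The coordinate of N is 2^u times a unit: a neighbour with diagonal coordinates
    differs from it by a multiple of 2^(n-u), and a neighbour with s = 2 mod 4
    would give n <= u + 1, against 2u < n. *)
Lemma A_closed u t N M : (2 <= u)%N -> (2 * u < n)%N ->
  N \in A_block u t -> edge N M -> M \in A_block u t.
Proof.
move=> u2 un NA E; set x0 : ZG n := (2 * t + 1)%N%:R.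
have [x ox eN] : exists2 x : ZG n, odd x &
    N = vertex (2 ^+ u * x) (2 ^+ u * x) /\
    exists w, 2 ^+ u * x = 2 ^+ u * x0 + 2 ^+ (n - u) * w.
  move/imsetP: NA => [w _ ->].
  have e : 2 ^+ (n - u) = 2 ^+ u * (2 * 2 ^+ (n - u - u).-1) :> ZG n.
    by rewrite -exprS -exprD; congr (_ ^+ _); lia.
  exists (x0 + 2 * 2 ^+ (n - u - u).-1 * w).
    by rewrite -mulrA !oddrE odd_natr_odd.
  split; last by exists w; rewrite e; ring.
  by apply: vertex_congr; rewrite -/x0 e; ring.
have [eN1 [w ew]] := eN.
have e2 : 2 ^+ u * x = 2 * (2 * (2 ^+ (u - 2) * x)).
  by rewrite -{1}(subnK u2) addn2 !exprS; ring.
have MV : M \in vertices n by case/and5P: E.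
case: (vertices_mod4 MV) => [[s [es eM]]|[d [s [os A eM]]]].
  rewrite eN1 eM in E; have o1 : odd (2 ^+ u * x)%R = false by rewrite e2 odd2r.
  have [_ H _] := (edge_diag o1 (odd2r n_gt0 s)).1 E; rewrite eM.
  have H1 : 2 ^+ u * (2 ^+ u * x - 2 * s) = 0.
    by apply: (unit_mul_eq0 n_gt0 ox); rewrite -H; ring.
  have un' : (u <= n)%N by lia.
  have [w' H2] := (pow2_mul_eq0 n_gt0 _ un').1 H1.
  have e : 2 * s = 2 ^+ u * x0 + 2 ^+ (n - u) * (w - w').
    by apply: (lincomb (c := -1) H2); rewrite ew; ring.
  by rewrite e; apply: mem_ray.
rewrite eN1 eM e2 in E; have [H _] := (edge_mixed (odd2r n_gt0 _) os A).1 E.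
move: H; rewrite -e2 mulrA -exprS => /(pow2_unit_eq0 n_gt0 ox); lia.
Qed.

Lemma H_mem c : vertex (2 ^+ uphalf n * c) (2 ^+ uphalf n * c) \in H_block.
Proof. by have := mem_ray (0 : ZG n) (uphalf n) c; rewrite add0r. Qed.

Lemma H_memP N : N \in H_block ->
  exists c w, [/\ N = vertex (2 * c) (2 * c), odd c = false
                & 2 * c = 2 ^+ uphalf n * w].
Proof.
move/imsetP => [w _ ->].
have e : 2 ^+ uphalf n = 2 * (2 * 2 ^+ (uphalf n - 2)) :> ZG n.
  by rewrite -!exprS; congr (_ ^+ _); lia.
exists (2 * (2 ^+ (uphalf n - 2) * w)), w; rewrite add0r oddrE; split=> //.
  by apply: vertex_congr; rewrite e; ring.
by rewrite e; ring.
Qed.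

Lemma torsion2_H c : 2 * c = 0 -> vertex c c \in H_block.
Proof.
move=> H; have : exists w, c = 2 ^+ uphalf n * w.
  have [->|->] := mul2_eq0 n_ge3 H; first by exists 0; rewrite mulr0.
  exists (2 ^+ (n - 1 - uphalf n)); rewrite -exprD quarter_mul2 //.
  by congr (_ ^+ _); lia.
by move=> [w ->]; apply: H_mem.
Qed.

Definition main_block := H_block :|: E_block.

(** From a multiple of 2^ceil(n/2), edges to diagonal coordinates have a difference
    of square zero, and [edge_mixed] handles the other type.  From N_3, ..., N_6,
    an edge into some S_k is excluded by [S_closed]. *)
Lemma main_closed N M : N \in main_block -> edge N M -> M \in main_block.
Proof.
move=> NK E; have MV : M \in vertices n by case/and5P: E.
have oq := odd_quarter n_ge3; rewrite inE.
case/setUP: NK => [/H_memP[c [w [eN ec ew]]]|/E_blockP[d0 [s0 [eN os0 A0 Hd0 Hs0]]]].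
  case: (vertices_mod4 MV) => [[s [es eM]]|[d [s [os A eM]]]].
    rewrite eN eM in E.
    have [_ H1 H2] := (edge_diag (odd2r n_gt0 c) (odd2r n_gt0 s)).1 E.
    have /(sqr_eq0 n_gt0)[w' ew'] : (2 * c - 2 * s) * (2 * c - 2 * s) = 0.
      by apply: (lincomb (c := 1) H1); apply: (lincomb (c := -1) H2); ring.
    have e : 2 * s = 2 ^+ uphalf n * (w - w').
      by apply: (lincomb (c := -1) ew'); rewrite ew; ring.
    by rewrite eM e H_mem.
  rewrite eN eM in E; have [_ Hd] := (edge_mixed ec os A).1 E.
  apply/orP; right; rewrite eM.
  have [d' o ed] : exists2 d' : ZG n, odd d' = false & d = 2 * d'.
    have [->|->] := mul2_eq0 n_ge3 Hd; first by exists 0; rewrite ?mulr0.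
    by exists (quarter n).
  by rewrite ed in A *; apply: admissible_mod4_2.
case: (vertices_mod4 MV) => [[s [es eM]]|[d [s [os A eM]]]].
  rewrite eN eM edge_sym // in E; have [Hs _] := (edge_mixed es os0 A0).1 E.
  by rewrite eM torsion2_H.
rewrite eM; have [->|[n4 [k kn MS]]] := admissible_mod4_2P n_ge3 os A.
  by rewrite orbT.
rewrite eM edge_sym // in E.
have := S_closed n4 MS E; rewrite eN; have [ed0 es0 _ _] := A0.
move/(mem_quad n_ge3) => [||||]; rewrite ?oddrE // => H _.
have : 2 ^+ 3 * (2 * k + 1)%N%:R = 0 :> ZG n.
  by apply: (lincomb (c := 1) Hd0); apply: (lincomb (c := -1) H); ring.
by move/(pow2_unit_eq0 n_gt0 (odd_natr_odd k)); lia.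
Qed.

End Closure.

(** * The connected components *)

(** Connected nonempty blocks that no edge leaves are the classes. *)
Lemma equivalence_partition_eq (T : finType) (e : rel T) (V : {set T})
    (P : {set {set T}}) :
  symmetric e ->
  (forall K, K \in P -> exists x, x \in K) ->
  (forall K, K \in P -> K \subset V) ->
  (forall x, x \in V -> exists2 K, K \in P & x \in K) ->
  (forall K, K \in P -> {in K &, forall x y, connect e x y}) ->
  (forall K, K \in P -> forall x y, x \in K -> e x y -> y \in K) ->
  equivalence_partition (connect e) V = P.
Proof.
move=> e_sym P_ne P_sub P_cov P_conn P_closed.
have cl K x : K \in P -> x \in K -> [set y in V | connect e x y] = K.
  move=> KP xK; have Kcl : closed e (mem K).
    apply: intro_closed; first exact: sym_connect_sym.
    by move=> y z eyz yK; apply: (P_closed K KP y z).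
  apply/setP => y; rewrite inE; apply/andP/idP => [[_ xy]|yK].
    by rewrite -(closed_connect Kcl xy).
  by split; [apply: (subsetP (P_sub K KP))|apply: (P_conn K KP)].
apply/setP => K; apply/imsetP/idP => [[x xV ->]|KP].
  by have [L LP xL] := P_cov x xV; rewrite (cl L).
by have [x xK] := P_ne K KP; exists x; rewrite ?(cl K) // (subsetP (P_sub K KP)).
Qed.

Section Assembly.

Variable n : nat.
Hypothesis n_ge3 : (3 <= n)%N.
Implicit Types (c d s x y z w : ZG n) (N M : {set {perm ZG n}}).

Let n_gt0 : (0 < n)%N. Proof. by case: n n_ge3. Qed.
Let n_gt1 : (1 < n)%N. Proof. by case: n n_ge3 => [|[]]. Qed.
Let oddrE := oddrE n_gt0.

Lemma Hset_block : Hset n = H_block n.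
Proof. exact: Hset_ray. Qed.

Lemma N3456_block : [set N3 n; N4 n; N5 n; N6 n] = E_block n.
Proof.
rewrite N3E // N4E // N5E // N6E // /E_block /quad !add0r.
rewrite (addrC (- 2)); apply/setP => N; rewrite !inE.
by do 4!case: (N == _).
Qed.

Lemma N12_H : N1 n \in H_block n /\ N2 n \in H_block n.
Proof.
rewrite N1E N2E //; split; apply: torsion2_H => //; first by rewrite mulr0.
by rewrite -(quarter_mul4 n_ge3); ring.
Qed.

Lemma main_component_block : main_component n = main_block n.
Proof.
have [H1 H2] := N12_H; rewrite /main_component /main_block Hset_block.
rewrite -N3456_block; apply/setP => N; rewrite !inE.
have [->|_] := eqVneq N (N1 n); first by rewrite H1.
by have [->|_] := eqVneq N (N2 n); first by rewrite H2.
Qed.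

Lemma A_familyP K : K \in A_family n <-> exists u t,
  [/\ (2 <= u < uphalf n)%N, (t < 2 ^ (n - 2 * u - 1))%N & K = A_block n u t].
Proof.
split=> [/bigcupP[u u2 /imsetP[t _ ->]]|[u [t [/andP[u2 uU] tlt ->]]]].
  have uU := ltn_ord u.
  by exists u, t; split; rewrite ?u2 ?ltn_ord ?Aset_ray //; lia.
apply/bigcupP; exists (Ordinal uU) => //; apply/imsetP.
by exists (Ordinal tlt); rewrite //= Aset_ray //; lia.
Qed.

Lemma S_familyP K : K \in S_family n <->
  (4 <= n)%N /\ exists2 k, (k < 2 ^ (n - 3))%N & K = S_block n k.
Proof.
split=> [/imsetP[k]|[n4 [k kn ->]]].
  by rewrite inE => n4 ->; split=> //; exists k; rewrite ?Sset_quad.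
by apply/imsetP; exists (Ordinal kn); rewrite ?inE //= Sset_quad.
Qed.

Lemma A_block_vertices u t :
  (2 <= u < uphalf n)%N -> A_block n u t \subset vertices n.
Proof.
move=> uU; apply: ray_vertices => //; last by lia.
by rewrite (_ : u = (u.-1).+1) ?exprS ?oddrE //; lia.
Qed.

Lemma A_block_even u t :
  (2 <= u)%N -> odd (2 ^+ u * (2 * t + 1)%N%:R : ZG n)%R = false.
Proof. by case: u => // u _; rewrite exprS !oddrE. Qed.

Lemma A_clique u t : (2 <= u < uphalf n)%N -> clique (A_block n u t).
Proof.
move=> uU; apply: ray_clique => //; try lia; first by rewrite A_block_even //; lia.
by rewrite mulrA -exprD subnK ?pow2n0 ?mul0r //; lia.
Qed.

Lemma H_clique : clique (H_block n).
Proof. by apply: ray_clique => //; rewrite ?mulr0 //; lia. Qed.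

Lemma clique_connect (K : {set {set {perm ZG n}}}) :
  clique K -> {in K &, forall N M, connect (@edge n) N M}.
Proof.
move=> cK N M NK MK; have [->|ne] := eqVneq N M; first exact: connect0.
exact/connect1/cK.
Qed.

Lemma vertex00_H : vertex (0 : ZG n) 0 \in H_block n.
Proof. by apply: torsion2_H; rewrite ?mulr0. Qed.

Lemma vertex0_E : vertex (0 : ZG n) (- 2) \in E_block n.
Proof. by rewrite /E_block /quad !inE eqxx. Qed.

Lemma S_block_base k :
  vertex (2 * (2 * k + 1)%N%:R : ZG n) (2 * (2 * k + 1)%N%:R) \in S_block n k.
Proof. by rewrite /S_block /quad !inE eqxx. Qed.

Lemma A_block_base u t :
  vertex (2 ^+ u * (2 * t + 1)%N%:R : ZG n) (2 ^+ u * (2 * t + 1)%N%:R)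
    \in A_block n u t.
Proof.
have := mem_ray (2 ^+ u * (2 * t + 1)%N%:R : ZG n) (n - u) 0.
by rewrite mulr0 addr0.
Qed.

(** Both cliques H and N_3, ..., N_6 are reached from N_1, through its edge to N_4. *)
Lemma main_connect : {in main_block n &, forall N M, connect (@edge n) N M}.
Proof.
have e_sym := sym_connect_sym (@edge_sym n).
have E : edge (vertex (0 : ZG n) 0) (vertex 0 (- 2)).
  have A : admissible (0 : ZG n) (2 * - 1).
    by split; rewrite ?oddrE //; ring.
  have := (edge_mixed n_ge3 (erefl : odd (0 : ZG n)%R = false) _ A).2.
  rewrite !oddrE !mulr0 mulrN mulr1; exact.
suff to0 N : N \in main_block n -> connect (@edge n) N (vertex 0 0).
  by move=> N M /to0 NC /to0 MC; apply: connect_trans NC _; rewrite e_sym.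
case/setUP => NK; first exact: (clique_connect H_clique NK vertex00_H).
rewrite e_sym; apply: connect_trans (connect1 E) _.
exact: (clique_connect (E_clique n_ge3) vertex0_E NK).
Qed.

Lemma components_eq :
  connected_components n = main_component n |: (A_family n :|: S_family n).
Proof.
rewrite main_component_block; apply: equivalence_partition_eq.
- exact: edge_sym.
- move=> K /setU1P[->|/setUP[/A_familyP[u [t [_ _ ->]]]|/S_familyP[_ [k _ ->]]]].
  + by exists (vertex 0 0); rewrite inE vertex00_H.
  + by eexists; apply: A_block_base.
  by eexists; apply: S_block_base.
- move=> K /setU1P[->|/setUP[/A_familyP[u [t [uU _ ->]]]|/S_familyP[_ [k _ ->]]]].
  + by rewrite subUset E_vertices // ray_vertices //; lia.
  + exact: A_block_vertices.
  exact: S_vertices.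
- move=> N /(vertices_mod4 n_ge3)[[s [es ->]]|[d [s [os A ->]]]]; last first.
    have [H|[n4 [k kn H]]] := admissible_mod4_2P n_ge3 os A.
      by exists (main_block n); rewrite ?setU11 // inE H orbT.
    exists (S_block n k) => //; rewrite !inE; apply/orP; right; apply/orP; right.
    by apply/S_familyP; split=> //; exists k.
  have [u [k [un kn ec]]] := val2_ex n_gt0 (2 * s).
  have [uU|uU] := leqP (uphalf n) u.
    exists (main_block n); rewrite ?setU11 // inE ec -(subnKC uU) exprD -mulrA.
    by rewrite H_mem.
  (* 2 s is a multiple of 4, so its valuation u is at least 2. *)
  have u2 : (2 <= u)%N.
    have o := odd_natr_odd n_ge3 k; have [s' es'] := evenP n_gt0 es.
    have E : 4 * s' = 2 ^+ u * (2 * k + 1)%N%:R by rewrite -ec es'; ring.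
    case: u {un uU ec} E => [|[|//]] E.
      have e4 : 4 * s' = 2 * (2 * s') by ring.
      by have := o; rewrite -[_%:R]mul1r -[1]/(2 ^+ 0 : ZG n) -E e4 oddrE.
    suff : 2 * 1 = 0 :> ZG n by rewrite mulr1 => /(two_neq0 n_gt1).
    have o' : odd (2 * s' - (2 * k + 1)%N%:R)%R by rewrite !oddrE o.
    by apply: (unit_mul_eq0 n_gt0 o'); apply: (lincomb (c := 1) E); ring.
  pose t := (k %% 2 ^ (n - 2 * u - 1))%N.
  have un2 : (2 * u < n)%N by lia.
  exists (A_block n u t).
    rewrite !inE; apply/orP; right; apply/orP; left; apply/A_familyP.
    by exists u, t; rewrite u2 uU ltn_mod expn_gt0.
  rewrite /A_block -Aset_ray // ec -subgroup_of_gamma_c //; apply/imsetP.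
  by exists (Ordinal kn); rewrite // inE /t /= modn_mod.
- move=> K /setU1P[->|/setUP[/A_familyP[u [t [uU _ ->]]]|/S_familyP[_ [k _ ->]]]].
  + exact: main_connect.
  + exact/clique_connect/A_clique.
  exact/clique_connect/S_clique.
move=> K /setU1P[->|/setUP[/A_familyP[u [t [uU _ ->]]]|/S_familyP[n4 [k _ ->]]]] N M.
- exact: main_closed.
- by apply: A_closed => //; lia.
exact: S_closed.
Qed.

(** * The edges of the main component *)

Lemma low_torsion d s : odd d = false -> odd s = false ->
  vertex d s \in [set N1 n; N2 n; N3 n; N4 n] -> 2 * d = 0.
Proof.
move=> ed es.
rewrite N1E N2E // N3E // N4E // !inE -!orbA.
case/or4P => /eqP/(vertex_eq n_gt0 ed es) []; rewrite ?oddrE // => -> _; rewrite ?mulr0 //.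
by rewrite -(quarter_mul4 n_ge3); ring.
Qed.

Lemma H_low c : 2 * c = 0 -> vertex c c \in [set N1 n; N2 n; N3 n; N4 n].
Proof.
rewrite N1E N2E // => /(mul2_eq0 n_ge3)[->|->]; by rewrite !inE eqxx ?orbT.
Qed.

Lemma E_low d s : odd d = false -> 2 * d = 0 -> 2 * (s + 2) = 0 ->
  odd s = false ->
  vertex d s \in [set N1 n; N2 n; N3 n; N4 n].
Proof.
move=> ed Hd /(mul2_eq0 n_ge3) Hs es; rewrite N3E // N4E // !inE.
have V s' : odd s' = false -> s = s' -> vertex d s == vertex 0 s'.
  by move=> es' <-; apply/eqP/(vertex_eq n_gt0); rewrite ?mulr0.
case: Hs => Hs; first by rewrite (V (- 2)) ?orbT ?oddrE //;
  apply: (lincomb (c := 1) Hs); ring.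
rewrite (V (2 * quarter n - 2)) ?orbT ?oddrE //; apply: (lincomb (c := 1) Hs); ring.
Qed.

Lemma H_E_disjoint N : N \in H_block n -> N \in E_block n -> False.
Proof.
move=> /(H_memP n_ge3)[c [w [-> ec _]]] /(E_blockP n_ge3)[d [s [E os A _ _]]].
have [ed es _ _] := A.
have [_ E2] := (vertex_eq n_gt0 (odd2r n_gt0 c) (odd2r n_gt0 c) ed es).1 E.
have o : odd (c - s)%R by rewrite !oddrE ec os.
apply: (two_neq0 n_gt1); apply: (unit_mul_eq0 n_gt0 o).
by apply: (lincomb (c := 1) E2); ring.
Qed.

(** By [edge_mixed] an edge between H and N_3, ..., N_6 means that 2 c = 0 and
    2 d = 0, that is, that the ends are among N_1, N_2 and among N_3, N_4. *)
Lemma main_edge_HE N M : N \in H_block n -> M \in E_block n ->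
  edge N M = (N \in [set N1 n; N2 n; N3 n; N4 n]) &&
             (M \in [set N1 n; N2 n; N3 n; N4 n]).
Proof.
move=> /(H_memP n_ge3)[c [w [-> ec _]]] /(E_blockP n_ge3)[d [s [-> os A H1 H2]]].
have [ed es _ _] := A; have e2c := odd2r n_gt0 c.
apply/idP/andP => [/(edge_mixed n_ge3 ec os A)[Hc Hd]|].
  by split; [apply: H_low|apply: E_low].
move=> [/(low_torsion e2c e2c) Hc /(low_torsion ed es) Hd].
exact/(edge_mixed n_ge3 ec os A).
Qed.

Lemma main_edges : {in main_component n &, forall N M, edge N M =
        (N != M) &&
        [|| (N \in Hset n) && (M \in Hset n),
            (N \in [set N1 n; N2 n; N3 n; N4 n]) &&
            (M \in [set N1 n; N2 n; N3 n; N4 n])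
          | (N \in [set N3 n; N4 n; N5 n; N6 n]) &&
            (M \in [set N3 n; N4 n; N5 n; N6 n])]}.
Proof.
have edge_neq N M : edge N M -> N != M by case/and5P.
have notE N : N \in H_block n -> (N \in E_block n) = false.
  by move=> NH; apply/negP/(H_E_disjoint NH).
have notH N : N \in E_block n -> (N \in H_block n) = false.
  by move=> NE; apply/negP => /H_E_disjoint/(_ NE).
rewrite main_component_block Hset_block N3456_block => N M.
case/setUP => NK /setUP[] MK;
  rewrite ?NK ?MK ?(notE _ NK) ?(notE _ MK) ?(notH _ NK) ?(notH _ MK) /=;
  rewrite ?orbF ?orbT ?andbT ?andbF /=.
- by apply/idP/idP => [/edge_neq|]//; apply: H_clique.
- rewrite -main_edge_HE //; apply/idP/andP => [E|[]//]; split=> //; exact: edge_neq E.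
- rewrite andbC [_ && (M \in _)]andbC -main_edge_HE // edge_sym //.
  by apply/idP/andP => [E|[]//]; split=> //; rewrite eq_sym; apply: edge_neq E.
by apply/idP/idP => [/edge_neq|]//; apply: E_clique.
Qed.

(** * Cardinalities, and the separation of the three families *)

Lemma card_Hset : #|Hset n| = (2 ^ (n - uphalf n))%N.
Proof. by rewrite Hset_block card_ray //; lia. Qed.

Lemma card_main : #|main_component n| = (2 ^ (n - uphalf n) + 4)%N.
Proof.
rewrite main_component_block /main_block cardsU -Hset_block card_Hset Hset_block.
rewrite card_quad ?oddrE // (_ : _ :&: _ = set0) ?cards0 ?subn0 //.
by apply/setP => N; rewrite in_set0; apply/negP => /setIP[NH] /(H_E_disjoint NH).
Qed.

(** The valuation of the coordinates in A_u^t is u, and their residues modulo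
    2^(n-u) determine t. *)
Lemma A_block_inj u t u' t' :
  (2 <= u < uphalf n)%N -> (2 <= u' < uphalf n)%N ->
  (t < 2 ^ (n - 2 * u - 1))%N -> (t' < 2 ^ (n - 2 * u' - 1))%N ->
  A_block n u t = A_block n u' t' -> u = u' /\ t = t'.
Proof.
move=> hu hu' ht ht' E.
have := A_block_base u t; rewrite E => /imsetP[w _].
have ec := @A_block_even u t; have hn : (0 < n - u')%N by lia.
move/(vertex_eq n_gt0) => []; rewrite ?ec //; try lia.
- by rewrite -(prednK hn) exprS -mulrA !oddDr // !A_block_even ?odd2r //; lia.
- by rewrite -(prednK hn) exprS -mulrA !oddDr // !A_block_even ?odd2r //; lia.
move=> _ E1.
have e : 2 ^+ (n - u') = 2 ^+ u' * (2 * 2 ^+ (n - u' - u').-1) :> ZG n.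
  by rewrite -exprS -exprD; congr (_ ^+ _); lia.
have uu' : u = u'.
  have o := odd_natr_odd n_ge3.
  apply: (@val2_uniq n n_gt0 _ _ (2 * t + 1)%N%:R
    ((2 * t' + 1)%N%:R + 2 * 2 ^+ (n - u' - u').-1 * w)); rewrite ?o //; try lia.
    by rewrite -mulrA oddDr // odd2r // o.
  by rewrite E1 e; ring.
subst u'; split=> //.
have hk : (2 * u + 1 <= n)%N by lia.
have : 2 ^+ (2 * u + 1) * t%:R = 2 ^+ (2 * u + 1) * t'%:R :> ZG n.
  have p0 : 2 ^+ u * 2 ^+ (n - u) = 0 :> ZG n by rewrite -exprD subnKC ?pow2n0 //; lia.
  rewrite !natr_odd in E1; rewrite mul2n -addnn !exprD expr1.
  by apply: (lincomb (c := 2 ^+ u) E1); apply: (lincomb (c := w) p0); ring.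
move/(pow2_mul_natr_eq n_gt0 _ _ hk); rewrite subnDA !modn_small //.
Qed.

Lemma card_A_block u t : (2 <= u < uphalf n)%N -> #|A_block n u t| = (2 ^ u)%N.
Proof.
move=> hu; rewrite card_ray ?A_block_even //; try lia.
by rewrite subKn //; lia.
Qed.

Lemma card_A_family :
  #|A_family n| = (\sum_(u < uphalf n | 2 <= u) 2 ^ (n - 2 * u - 1))%N.
Proof.
rewrite /A_family big_mkcond /= -sum1_card.
rewrite partition_disjoint_bigcup /= => [|u v uv]; last first.
  rewrite -setI_eq0; apply/eqP/setP => K; rewrite !inE; apply/negP => /andP[].
  case: ifP; rewrite ?inE // => u2 /imsetP[t _ ->]; case: ifP; rewrite ?inE // => v2.
  case/imsetP => t' _; have uU := ltn_ord u; have vU := ltn_ord v.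
  rewrite !Aset_ray //; try lia.
  move/A_block_inj => []; rewrite ?u2 ?v2 ?ltn_ord // => /val_inj E.
  by rewrite E eqxx in uv.
rewrite [RHS]big_mkcond; apply: eq_bigr => u _; case: ifP => u2; last first.
  by rewrite big_set0.
have uU := ltn_ord u; rewrite sum1_card card_imset ?card_ord // => t t'.
rewrite !Aset_ray //; try lia.
by move/A_block_inj => []; rewrite ?u2 ?ltn_ord // => _ /val_inj.
Qed.

Lemma geometric_sum U : (2 <= U)%N -> (2 * U <= n.+1)%N ->
  (3 * \sum_(u < U | 2 <= u) 2 ^ (n - 2 * u - 1) + 2 ^ (n.+1 - 2 * U) = 2 ^ (n - 3))%N.
Proof.
elim: U => // U IH U2 Un; have [U1|U1] := leqP U 1.
  have -> : U = 1%N by lia.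
  by rewrite big_pred0 => [|[[|[|//]] //]]; rewrite muln0; congr (2 ^ _)%N; lia.
rewrite big_mkcond big_ord_recr /= -big_mkcond /= U1 -IH //; last by lia.
have -> : (n - 2 * U - 1 = n.+1 - 2 * U.+1)%N by lia.
have -> : (n.+1 - 2 * U = (n.+1 - 2 * U.+1).+2)%N by lia.
by rewrite !expnS; ring.
Qed.

Lemma card_A_family_rat : (#|A_family n|%:R : rat) =
     1 / 3 * (2 ^ (n%:Z - 3) - 2 ^ (n%:Z - 2 * (uphalf n)%:Z + 1)).
Proof.
have U2 : (2 <= uphalf n)%N by lia.
have Un : (2 * uphalf n <= n.+1)%N by lia.
have := geometric_sum U2 Un; rewrite -card_A_family => /(congr1 (fun m => m%:R : rat)).
rewrite natrD natrM !natrX => H.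
have -> : (n%:Z - 3)%R = (n - 3)%N by lia.
have -> : (n%:Z - 2 * (uphalf n)%:Z + 1)%R = (n.+1 - 2 * uphalf n)%N by lia.
by rewrite -!exprnP -H; field.
Qed.

Lemma S_block_inj k k' :
  (4 <= n)%N -> (k < 2 ^ (n - 3))%N -> (k' < 2 ^ (n - 3))%N ->
  S_block n k = S_block n k' -> k = k'.
Proof.
move=> n4 hk hk' E.
have := S_block_base k; rewrite E => /(mem_quad n_ge3)[]; rewrite ?odd2r //.
rewrite !natr_odd // => _ H.
have : 2 ^+ 3 * k%:R = 2 ^+ 3 * k'%:R :> ZG n by apply: (lincomb (c := 1) H); ring.
by move/(pow2_mul_natr_eq n_gt0 _ _ n_ge3); rewrite !modn_small.
Qed.

Lemma card_S_family : (4 <= n)%N -> #|S_family n| = (2 ^ (n - 3))%N.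
Proof.
move=> n4; rewrite /S_family card_in_imset => [|k k' _ _]; last first.
  by rewrite !Sset_quad // => /S_block_inj E; apply/val_inj/E.
by rewrite -[RHS]card_ord; apply: eq_card => k; rewrite !inE n4.
Qed.

(** Modulo 4, the second coordinate s is 0 in every A_u^t and 2 in every S_k, but
    takes both values in the main component, at N_1 and at N_4. *)
Lemma main_notin : main_component n \notin A_family n :|: S_family n.
Proof.
rewrite main_component_block; apply/negP; case/setUP.
  move=> /A_familyP[u [t [hu _ E]]].
  have : vertex (0 : ZG n) (- 2) \in main_block n by rewrite inE vertex0_E orbT.
  have e u' : (0 < u')%N -> 2 ^+ u' = 2 * 2 ^+ u'.-1 :> ZG n.
    by case: u' => // u' _; rewrite exprS.
  have -> : - 2 = 2 * - 1 :> ZG n by ring.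
  rewrite E => /imsetP[w _ /(vertex_eq n_gt0)[]]; rewrite ?odd2r //.
  - by rewrite (e (n - u)%N) ?oddDr -?mulrA ?odd2r ?A_block_even //; lia.
  - by rewrite (e (n - u)%N) ?oddDr -?mulrA ?odd2r ?A_block_even //; lia.
  have -> : 2 ^+ (n - u) = 2 * (2 * 2 ^+ (n - u - 2)) :> ZG n.
    by rewrite -!exprS; congr (_ ^+ _); lia.
  have -> : 2 ^+ u = 2 * (2 * 2 ^+ (u - 2)) :> ZG n.
    by rewrite -!exprS; congr (_ ^+ _); lia.
  set a := 2 ^+ (u - 2); set b := 2 ^+ _; set c := (_ + 1)%N%:R => _ H.
  apply: (two_neq0 n_gt1).
  have o : odd (- 1 - 2 * (a * c) - 2 * (b * w))%R by rewrite !oddrE.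
  by apply: (unit_mul_eq0 n_gt0 o); apply: (lincomb (c := 1) H); ring.
move=> /S_familyP[n4 [k _ E]].
have : vertex (0 : ZG n) 0 \in main_block n by rewrite inE vertex00_H.
rewrite E => /(mem_quad n_ge3)[]; rewrite ?odd2r // => _ H.
have : 2 ^+ 2 * (2 * k + 1)%N%:R = 0 :> ZG n.
  by apply: (lincomb (c := - 1) H); ring.
by move/(pow2_unit_eq0 n_gt0 (odd_natr_odd n_ge3 k)); lia.
Qed.

(** Same invariant: s modulo 4. *)
Lemma A_S_disjoint : [disjoint A_family n & S_family n].
Proof.
rewrite -setI_eq0; apply/eqP/setP => K; rewrite in_set0; apply/negP => /setIP[].
move=> /A_familyP[u [t [hu _ ->]]] /S_familyP[n4 [k _ E]].
have := A_block_base u t; rewrite E => /(mem_quad n_ge3)[];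
  rewrite ?odd2r ?A_block_even //; try lia.
have o := odd_natr_odd n_ge3.
have -> : 2 ^+ u = 2 * (2 * 2 ^+ (u - 2)) :> ZG n.
  by rewrite -!exprS; congr (_ ^+ _); lia.
set a := 2 ^+ (u - 2); set c := (2 * t + 1)%N%:R; set c' := (2 * k + 1)%N%:R => _ H.
have oc : odd (2 * (a * c) - c')%R by rewrite !oddrE o.
have : 2 ^+ 2 = 0 :> ZG n.
  by apply: (unit_mul_eq0 n_gt0 oc); apply: (lincomb (c := 1) H); ring.
by move/(pow2_eq0 n_gt0); lia.
Qed.

End Assembly.

Unset Implicit Arguments.

Theorem theorem4p46 (n : nat) (hn : (3 <= n)%N) :
  (* the connected components are exactly main_component,
     the A_u^t and the S_k, without repetition between the three families *)
  [/\ connected_components n = main_component n |: (A_family n :|: S_family n),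
      main_component n \notin A_family n :|: S_family n
    & [disjoint A_family n & S_family n]] /\
  (* (i) *)
  [/\ #|main_component n| = (2 ^ (n - uphalf n) + 4)%N,
      #|Hset n| = (2 ^ (n - uphalf n))%N,
      clique (Hset n),
      N1 n \in Hset n /\ N2 n \in Hset n
    & {in main_component n &, forall N M, edge N M =
        (N != M) &&
        [|| (N \in Hset n) && (M \in Hset n),
            (N \in [set N1 n; N2 n; N3 n; N4 n]) &&
            (M \in [set N1 n; N2 n; N3 n; N4 n])
          | (N \in [set N3 n; N4 n; N5 n; N6 n]) &&
            (M \in [set N3 n; N4 n; N5 n; N6 n])]}] /\
  (* (ii) *)
  ((#|A_family n|%:R : rat) =
     1 / 3 * (2 ^ (n%:Z - 3) - 2 ^ (n%:Z - 2 * (uphalf n)%:Z + 1)) /\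
   forall u t : nat, (2 <= u < uphalf n)%N -> (t < 2 ^ (n - 2 * u - 1))%N ->
     clique (Aset n u t) /\ #|Aset n u t| = (2 ^ u)%N) /\
  (* (iii) *)
  ((4 <= n)%N ->
     #|S_family n| = (2 ^ (n - 3))%N /\
     forall k : nat, (k < 2 ^ (n - 3))%N ->
       clique (Sset n k) /\ #|Sset n k| = 4%N).
Proof.
have [N1H N2H] := N12_H hn.
split; first by split; [apply: components_eq|apply: main_notin|apply: A_S_disjoint].
split.
  split; [exact: card_main|exact: card_Hset| |by rewrite Hset_block|exact: main_edges].
  by rewrite Hset_block //; apply: H_clique.
split=> [|n4].
  split=> [|u t hu _]; first exact: card_A_family_rat.
  by rewrite Aset_ray //; [split; [apply: A_clique|apply: card_A_block]| |]; lia.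
split=> [|k _]; first exact: card_S_family.
rewrite Sset_quad //; split; first exact: S_clique.
have o : odd ((2 : ZG n) * (2 * k + 1)%N%:R)%R = false.
  by apply: odd2r; apply: ltnW; apply: ltnW.
by rewrite card_quad.
Qed.
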